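(* Let $\varepsilon>0$ be a constant. There exists a constant $k_\varepsilon$ such that the following holds: if $G=(V,E)$ is a graph on $n$ vertices with minimum degree $\delta(G)\geq\left(\frac12+\varepsilon\right)n$ and $k\geq k_\varepsilon$ is a constant integer, then with high probability (as $n\to\infty$) the random graph $G_k$ is Hamiltonian.
   Context: For a fixed graph $G=(V,E)$ and a positive integer $k$, the random graph $G_k$ is obtained as follows: each vertex $v\in V$ independently chooses a uniformly random set of $k$ distinct neighbors of $v$ in $G$ (choices without replacement), and $G_k$ is the graph on $V$ whose edges are the pairs $\{v,w\}$ such that $v$ chose $w$ or $w$ chose $v$. $G$ is regarded as one member of a sequence of graphs with $n\to\infty$; ''with high probability'' means with probability tending to $1$ as $n\to\infty$. *)

(* Defs.v *)
From HB Require Import structures.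
From mathcomp Require Import all_boot all_order all_algebra.
From mathcomp Require Export reals.
Set Implicit Arguments. Unset Strict Implicit. Unset Printing Implicit Defensive.
Import Order.TTheory GRing.Theory Num.Theory.
Local Open Scope ring_scope.

Definition simple_graph (n : nat) (e : rel 'I_n) : Prop :=
  symmetric e /\ irreflexive e.

Definition nbhd (n : nat) (e : rel 'I_n) (v : 'I_n) : {set 'I_n} :=
  [set w | e v w].

Definition valid_choice (n : nat) (e : rel 'I_n) (k : nat)
  (c : {ffun 'I_n -> {set 'I_n}}) : bool :=
  [forall v, (c v \subset nbhd e v) && (#|c v| == k)].

Definition Gk_rel (n : nat) (c : {ffun 'I_n -> {set 'I_n}}) : rel 'I_n :=
  fun v w => (w \in c v) || (v \in c w).

Definition hamiltonianb (n : nat) (r : rel 'I_n) : bool :=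
  (2 < n)%N && [exists s : n.-tuple 'I_n, uniq s && cycle r s].

(* P(G_k is Hamiltonian): each vertex independently picks a uniformly random
   k-subset of its neighbourhood, i.e. the configuration is uniform over the
   valid configurations. *)
Definition prob_Gk_ham (R : numFieldType) (n : nat) (e : rel 'I_n) (k : nat) : R :=
  (#|[set c : {ffun 'I_n -> {set 'I_n}} | valid_choice e k c && hamiltonianb (Gk_rel c)]|%:R
   / #|[set c : {ffun 'I_n -> {set 'I_n}} | valid_choice e k c]|%:R).

(* Main.v *)
(* Colouring argument of Fenner and Frieze combined with Posa rotations.

   With high probability the k-out choice [c] expands robustly: deleting any one
   choice [f v] at every vertex leaves a (k-1)-out choice [a] whose graph still
   expands. If [c] is not Hamiltonian, at least (k-2)^n of the k^n deletions [f]
   keep a longest path of [c], since a path uses at most two edges at a vertex.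
   For such [f] the longest paths of [a] and of [c] have the same length, so [f]
   must not complete a longest path of [a] to a cycle or to a longer path.

   By rotations, [a] has linearly many vertices [x] each joined by longest paths
   to linearly many vertices [y]. For each such pair, [f] must not choose
   consecutive vertices [f y], [f x] of the path. As all degrees in G exceed
   (1/2 + eps) n, neighbourhoods of [x] and [y] meet in linearly many such
   positions, so a uniform [f] avoids all of these events with probability at most
   exp(-beta n), where beta depends on [eps] only. Double counting pairs [(a, f)] shows
   that [c] is expanding and not Hamiltonian with probability at most
   (k/(k-2))^n exp(-beta n), which tends to 0 once k is large. *)

Require Import Defs.
From HB Require Import structures.
From mathcomp Require Import all_boot all_order all_algebra.
From mathcomp Require Import boolp reals.
From mathcomp Require Import zify ring lra.
Import Order.TTheory GRing.Theory Num.Theory.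
Local Open Scope ring_scope.
Set Implicit Arguments. Unset Strict Implicit. Unset Printing Implicit Defensive.

(** * Counting functions and sets *)

(** The sample space: independent choices at the vertices form this product, so probabilities become
    ratios of cardinalities. *)
Definition ffam (T U : finType) (F : T -> {set U}) : {set {ffun T -> U}} :=
  [set f : {ffun T -> U} | [forall v, f v \in F v]].

Lemma card_ffam (T U : finType) (F : T -> {set U}) :
  #|ffam F| = (\prod_v #|F v|)%N.
Proof.
rewrite -(eq_card (A := family (fun v => mem (F v)))) ?card_family.
  by rewrite foldrE big_image.
by move=> f; rewrite [RHS]inE; apply/familyP/forallP.
Qed.

Lemma ffamP (T U : finType) (F : T -> {set U}) (f : {ffun T -> U}) :
  reflect (forall v, f v \in F v) (f \in ffam F).
Proof. by rewrite inE; apply: forallP. Qed.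

(** Independence: the count factors over the coordinates, and each coordinate in [S] costs a factor
    [q]. *)
Lemma card_ffam_restrict (R : realFieldType) (T U : finType)
    (F F' : T -> {set U}) (S : {set T}) (q : R) : 0 <= q ->
  (forall v, v \in S -> #|F v :&: F' v|%:R <= q * #|F v|%:R) ->
  #|[set f in ffam F | [forall v in S, f v \in F' v]]|%:R
    <= q ^+ #|S| * #|ffam F|%:R :> R.
Proof.
move=> q0 hq.
pose F2 v := if v \in S then F v :&: F' v else F v.
have -> : [set f in ffam F | [forall v in S, f v \in F' v]] = ffam F2.
  apply/setP => f; apply/setIdP/ffamP => [[/ffamP hF /forallP hS] v|h].
    rewrite /F2; case: ifP => vS //; rewrite inE hF.
    by have := hS v; rewrite vS.
  split; first by apply/ffamP => v; have := h v; rewrite /F2; case: ifP => // _ /setIP[].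
  by apply/forall_inP => v vS; have := h v; rewrite /F2 vS => /setIP[].
rewrite !card_ffam !natr_prod.
have -> : q ^+ #|S| = \prod_v (if v \in S then q else 1).
  by rewrite -big_mkcond /= prodr_const.
rewrite -big_split /=; apply: ler_prod => v _; rewrite ler0n /= /F2.
by case: ifP => [/hq //|_]; rewrite mul1r.
Qed.

Lemma card_fibers (T K : finType) (X : {set T}) (r : T -> K) :
  #|X| = (\sum_g #|[set f in X | r f == g]|)%N.
Proof.
rewrite -sum1_card (partition_big r xpredT) //=.
by apply: eq_bigr => g _; rewrite -sum1_card; apply: eq_bigl => f; rewrite inE.
Qed.

(** Conditioning on the coordinates outside [S] freezes the sets [F' f], so the independent estimate
    applies on every fibre of the restriction map [r]. *)
Lemma card_ffam_adapted (R : realFieldType) (T U : finType) (F : T -> {set U})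
    (F' : {ffun T -> U} -> T -> {set U}) (S : {set T}) (Q : pred {ffun T -> U})
    (q : R) : 0 <= q ->
  (forall f g : {ffun T -> U}, (forall v, v \notin S -> f v = g v) -> F' f =1 F' g) ->
  (forall (f : {ffun T -> U}) v, Q f -> v \in S -> #|F v :&: F' f v|%:R <= q * #|F v|%:R) ->
  #|[set f in ffam F | Q f && [forall v in S, f v \in F' f v]]|%:R
    <= q ^+ #|S| * #|ffam F|%:R :> R.
Proof.
move=> q0 ext hq; set X := [set f in _ | _].
pose r (f : {ffun T -> U}) := [ffun v => if v \in S then None else Some (f v)].
rewrite (card_fibers X r) (card_fibers (ffam F) r) !natr_sum mulr_sumr.
apply: ler_sum => g _.
(* A fibre that misses [X] is trivial. Otherwise one element [f0] of it, satisfying [Q], supplies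
   the sets [F' f0] for the whole fibre. *)
have [->|[f0]] := set_0Vmem [set f in X | r f == g].
  by rewrite cards0 mulr_ge0 ?exprn_ge0 ?ler0n.
rewrite !inE => /andP[/andP[f0F /andP[f0Q _]] /eqP rg].
have agree f : r f = g -> forall v, v \notin S -> f v = f0 v.
  move=> rf v vS; have := congr1 (fun h : {ffun _ -> _} => h v) (etrans rf (esym rg)).
  by rewrite !ffunE (negPf vS) => -[].
pose Fg v := if v \in S then F v else [set f0 v].
have sub1 : [set f in X | r f == g] \subset
     [set f in ffam Fg | [forall v in S, f v \in F' f0 v]].
  apply/subsetP => f; rewrite !inE => /andP[/andP[fF /andP[fQ fS]] /eqP rf].
  apply/andP; split; apply/forallP => v; rewrite /Fg.
    by case: ifP => vS; [exact: (forallP fF) | rewrite inE (agree f) ?vS].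
  apply/implyP => vS; rewrite -(ext f f0 (agree f rf)).
  by apply: (forall_inP fS).
have sub2 : ffam Fg \subset [set f in ffam F | r f == g].
  apply/subsetP => f /ffamP hf; rewrite !inE; apply/andP; split.
    apply/forallP => v; have := hf v; rewrite /Fg; case: ifP => // _ /set1P ->.
    exact: (forallP f0F).
  rewrite -rg; apply/eqP/ffunP => v; rewrite !ffunE; case: ifP => // vS.
  by have := hf v; rewrite /Fg vS => /set1P ->.
apply: le_trans (_ : q ^+ #|S| * #|ffam Fg|%:R <= _); last first.
  by rewrite ler_wpM2l ?exprn_ge0 // ler_nat subset_leq_card.
apply: le_trans (_ : #|[set f in ffam Fg | [forall v in S, f v \in F' f0 v]]|%:R <= _).
  by rewrite ler_nat subset_leq_card.
apply: card_ffam_restrict => // v vS; rewrite /Fg vS; exact: hq.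
Qed.

(** * Binomial estimates and random subsets of fixed size *)

Lemma bin_le_exp2 (n m : nat) : ('C(n, m) <= 2 ^ n)%N.
Proof.
elim: n m => [|n IH] [|m] //; first by rewrite bin0 expn_gt0.
by rewrite binS expnS mul2n -addnn leq_add.
Qed.

(** Stirling with 4 in place of e: the falling factorial [(s + s) ^_ s] dominates [s ^ s] and equals
    a binomial coefficient, at most [4 ^ s], times the factorial of [s]. *)
Lemma expn_self_le_fact (s : nat) : (s ^ s <= 4 ^ s * s`!)%N.
Proof.
have h : (s ^ s <= (s + s) ^_ s)%N.
  have -> : (s ^ s = \prod_(i < s) s)%N by rewrite prod_nat_const card_ord.
  by rewrite ffact_prod; apply: leq_prod => i _; have := ltn_ord i; lia.
apply: leq_trans h _; rewrite -bin_ffact leq_mul2r; apply/orP; right.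
by rewrite addnn -mul2n (_ : 4 = 2 ^ 2)%N // -expnM bin_le_exp2.
Qed.

Lemma ffact_le_exp (n s : nat) : (n ^_ s <= n ^ s)%N.
Proof.
have -> : (n ^ s = \prod_(i < s) n)%N by rewrite prod_nat_const card_ord.
by rewrite ffact_prod; apply: leq_prod => i _; rewrite leq_subr.
Qed.

Lemma bin_mul_exp_le (n s : nat) : ('C(n, s) * s ^ s <= (4 * n) ^ s)%N.
Proof.
rewrite expnMn; apply: leq_trans (_ : 'C(n, s) * (4 ^ s * s`!) <= _)%N.
  by rewrite leq_mul2l expn_self_le_fact orbT.
by rewrite mulnCA leq_mul2l bin_ffact ffact_le_exp orbT.
Qed.

Lemma bin_le_div_exp (R : realFieldType) (n s : nat) : (0 < s)%N ->
  ('C(n, s))%:R <= (4 * n%:R / s%:R) ^+ s :> R.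
Proof.
move=> s0; rewrite exprMn exprVn ler_pdivlMr ?exprn_gt0 ?ltr0n //.
by rewrite -(natrM R 4 n) -!natrX -natrM ler_nat bin_mul_exp_le.
Qed.

(* Every such [U] is [u |: U'] for some [k]-subset [U'] of [S :&: N] and some [u] in [N :\: U']. *)
Lemma card_almost_sub (T : finType) (N S : {set T}) (k : nat) :
  (#|[set U : {set T} | [&& U \subset N, #|U| == k.+1 & #|U :\: S| <= 1]]|
     <= 'C(#|S :&: N|, k) * (#|N| - k))%N.
Proof.
pose P := [set U : {set T} | (U \subset S :&: N) && (#|U| == k)].
pose Q := [set Z : {set T} * T | (Z.1 \in P) && (Z.2 \in N :\: Z.1)].
apply: leq_trans (_ : #|[set (Z.2 |: Z.1) | Z in Q]| <= _)%N.
  apply/subset_leq_card/subsetP => U; rewrite inE => /and3P[UN /eqP Uk US].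
  have [u uU uS] : exists2 u, u \in U & U :\ u \subset S.
    have [US0|[u uUS]] := set_0Vmem (U :\: S).
      have /card_gt0P[u uU] : (0 < #|U|)%N by rewrite Uk.
      exists u => //; apply: subset_trans (subD1set _ _) _.
      by rewrite -setD_eq0 US0.
    exists u; first by case/setDP: uUS.
    apply/subsetP => w /setD1P[wu wU]; apply: contraT => wS.
    have : w \in U :\: S by rewrite inE wS.
    have /eqP : #|U :\: S| == 1%N by rewrite eqn_leq US; apply/card_gt0P; exists u.
    by move/eqP/cards1P => [z zE]; move: uUS; rewrite zE !inE => /eqP <- /eqP E; rewrite E eqxx in wu.
  apply/imsetP; exists (U :\ u, u); last by rewrite /= setD1K.
  rewrite !inE /= (subsetP UN) // eqxx /= andbT subsetI uS /=.
  rewrite (subset_trans (subD1set _ _) UN) /=.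
  by move: Uk; rewrite (cardsD1 u) uU add1n => -[->].
apply: leq_trans (leq_imset_card _ _) _.
rewrite -cards_draws -/P -sum1_card.
rewrite (eq_bigl (fun Z => (Z.1 \in P) && (Z.2 \in N :\: Z.1))); last first.
  by move=> Z; rewrite inE.
rewrite -(pair_big_dep (mem P) (fun A u => u \in N :\: A) (fun _ _ => 1%N)) /=.
rewrite -sum_nat_const; apply: leq_sum => A; rewrite inE => /andP[AS /eqP Ak].
rewrite sum1_card cardsD (setIidPr _) ?Ak //.
by apply: subset_trans AS (subsetIr _ _).
Qed.

(** Factor by factor, [s - i <= mu * (d - i)] because [mu <= 1]; once [i >= s] the truncated factor
    vanishes. *)
Lemma bin_le_exp_bin (R : realFieldType) (s d k : nat) (mu : R) :
  0 <= mu -> mu <= 1 -> s%:R <= mu * d%:R ->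
  ('C(s, k))%:R <= mu ^+ k * ('C(d, k))%:R.
Proof.
move=> mu0 mu1 smu; have f0 : 0 < (k`!)%:R :> R by rewrite ltr0n fact_gt0.
rewrite -(ler_pM2r f0) -mulrA -!natrM !bin_ffact !ffact_prod !natr_prod.
rewrite -[X in mu ^+ X](card_ord k) -prodr_const -big_split /=.
apply: ler_prod => i _; rewrite ler0n /=.
have [le_is|lt_si] := leqP s i.
  by rewrite (_ : s - i = 0)%N ?mulr_ge0 //; apply/eqP; rewrite subn_eq0.
have le_sd : (s <= d)%N.
  by rewrite -(ler_nat R); apply: le_trans smu _; rewrite ler_piMl.
rewrite !natrB ?(ltnW lt_si) ?(leq_trans (ltnW lt_si)) //.
by rewrite mulrBr lerB // ler_piMl.
Qed.

Definition ksets (T : finType) (N : {set T}) (k : nat) : {set {set T}} :=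
  [set U : {set T} | U \subset N & #|U| == k].

Lemma card_ksets (T : finType) (N : {set T}) (k : nat) :
  #|ksets N k| = 'C(#|N|, k).
Proof. exact: cards_draws. Qed.

(** One of the [k.+1] elements may leave [S]; the other [k] fall into [S] with probability at most
    [mu ^ k]. *)
Lemma card_almost_sub_le (R : realFieldType) (T : finType) (N S : {set T})
    (k : nat) (mu : R) : 0 <= mu -> mu <= 1 -> #|S|%:R <= mu * #|N|%:R ->
  #|ksets N k.+1 :&: [set U : {set T} | #|U :\: S| <= 1]%N|%:R
    <= (k.+1%:R * mu ^+ k) * #|ksets N k.+1|%:R.
Proof.
move=> mu0 mu1 hS.
have -> : ksets N k.+1 :&: [set U : {set T} | #|U :\: S| <= 1]%N
   = [set U : {set T} | [&& U \subset N, #|U| == k.+1 & #|U :\: S| <= 1]%N].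
  by apply/setP => U; rewrite !inE andbA.
apply: le_trans (_ : ('C(#|S :&: N|, k) * (#|N| - k))%:R <= _).
  by rewrite ler_nat card_almost_sub.
rewrite card_ksets mulrAC -natrM mul_bin_left mulnC !natrM -mulrA.
rewrite ler_wpM2l ?ler0n // mulrC; apply: bin_le_exp_bin => //.
by apply: le_trans hS; rewrite ler_nat subset_leq_card ?subsetIl.
Qed.

Lemma exists_subset_card (T : finType) (A : {set T}) (h : nat) :
  (h <= #|A|)%N -> exists2 B : {set T}, B \subset A & #|B| = h.
Proof.
rewrite -bin_gt0 -card_ksets => /card_gt0P[B].
by rewrite inE => /andP[? /eqP]; exists B.
Qed.

Lemma exists_superset_card (T : finType) (A : {set T}) (h : nat) :
  (#|A| <= h)%N -> (h <= #|T|)%N ->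
  exists2 B : {set T}, A \subset B & #|B| = h.
Proof.
move=> Ah hT; have [|B BA Bh] := @exists_subset_card T (~: A) (#|T| - h).
  by rewrite -(cardsC A); lia.
exists (~: B); first by rewrite -setCS setCK.
by have := cardsC B; lia.
Qed.

(** * Spreading choices and the union bound over sets *)

Definition spread (V : finType) (j : nat) (c : V -> {set V}) (S T : {set V}) :=
  [exists v in S, (j < #|c v :\: T|)%N].

(* Small sets expand by a factor 3 and medium sets are not closed. Deleting one
   choice at every vertex turns [j = 1] into [j = 0]. *)
Definition spreading (V : finType) (j : nat) (c : V -> {set V}) : bool :=
  [forall S : {set V}, (S != set0) ==>
    (if 12 * #|S| <= #|V| then
       [forall T : {set V}, (#|T| <= 3 * #|S|)%N ==> spread j c S T]
     else (2 * #|S| <= #|V|)%N ==> spread j c S S)%N].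

Lemma card_not_spread (R : realFieldType) (V : finType) (N : V -> {set V})
    (k : nat) (mu : R) (S T : {set V}) : 0 <= mu -> mu <= 1 ->
  (forall v, #|T|%:R <= mu * #|N v|%:R) ->
  #|[set c in ffam (fun v => ksets (N v) k.+1) | ~~ spread 1 c S T]|%:R
    <= (k.+1%:R * mu ^+ k) ^+ #|S| * #|ffam (fun v => ksets (N v) k.+1)|%:R.
Proof.
move=> mu0 mu1 hT.
have q0 : 0 <= k.+1%:R * mu ^+ k :> R by rewrite mulr_ge0 ?exprn_ge0.
apply: le_trans (card_ffam_restrict (S := S)
  (F' := fun=> [set U : {set V} | #|U :\: T| <= 1]%N) q0 _).
  rewrite ler_nat; apply/subset_leq_card/subsetP => c; rewrite !inE.
  case/andP=> -> /= /existsPn h; apply/forall_inP => v vS.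
  by have := h v; rewrite vS /= -leqNgt inE.
by move=> v _; apply: card_almost_sub_le.
Qed.

Lemma sum_exp_half_le1 (R : realFieldType) (m : nat) :
  \sum_(i < m) (2^-1 : R) ^+ i.+1 <= 1.
Proof.
suff -> : \sum_(i < m) (2^-1 : R) ^+ i.+1 = 1 - 2^-1 ^+ m.
  by rewrite gerBl exprn_ge0 // invr_ge0.
elim: m => [|m IH]; first by rewrite big_ord0 expr0 subrr.
by rewrite big_ord_recr /= IH !exprS; field.
Qed.

Lemma sum_card_weight (R : realFieldType) (V : finType) (a : nat -> R) :
  \sum_(S : {set V}) a #|S| = \sum_(s < #|V|.+1) ('C(#|V|, s))%:R * a s.
Proof.
rewrite (partition_big (fun S : {set V} => inord #|S| : 'I_#|V|.+1) xpredT) //=.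
apply: eq_bigr => s _.
have E (S : {set V}) : (inord #|S| == s) = (#|S| == s).
  by rewrite -val_eqE /= inordK // ltnS max_card.
rewrite (eq_bigr (fun=> a s)) => [|S]; last by rewrite E => /eqP ->.
rewrite sumr_const -(card_draws V s) mulr_natl; congr (_ *+ _).
by apply: eq_card => S; rewrite !inE -E -val_eqE.
Qed.

Lemma sum_small_sets (R : realFieldType) (V : finType) (a : nat -> R) (M : R) :
  0 <= M -> (forall s, (0 < s)%N -> (12 * s <= #|V|)%N -> 0 <= a s) ->
  (forall s, (0 < s)%N -> (12 * s <= #|V|)%N ->
    ('C(#|V|, s))%:R * a s <= M * 2^-1 ^+ s) ->
  \sum_(S : {set V} | (0 < #|S|)%N && (12 * #|S| <= #|V|)%N) a #|S| <= M.
Proof.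
move=> M0 a0 ha; rewrite big_mkcond /=.
rewrite (sum_card_weight V (fun s => if (0 < s)%N && (12 * s <= #|V|)%N then a s else 0)).
rewrite big_ord_recl /= mulr0 add0r.
apply: le_trans (_ : \sum_(i < #|V|) M * (2^-1 : R) ^+ i.+1 <= _).
  apply: ler_sum => i _; rewrite /bump /= add1n.
  by case: ifP => [/ha -> //|_]; rewrite mulr0 mulr_ge0 ?exprn_ge0 ?invr_ge0.
by rewrite -mulr_sumr ler_piMr // sum_exp_half_le1.
Qed.

(** At degrees of at least [n/2], [r = 6s/n <= 1/2] bounds the share of [3s] vertices in a
    neighbourhood. Of the [i + 5] factors [r], four cancel the two binomial bounds, one yields
    [6s/n], and the other [i] bring the rest down to 1/4. Of the resulting [4^-s], one [2^-s]
    absorbs the factor [s]. *)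
Lemma small_spread_term (R : realFieldType) (n s i : nat) :
  (0 < s)%N -> (12 * s <= n)%N -> 24 * 8 ^+ 3 * (i + 6)%:R * 2^-1 ^+ i <= 1 / 4 :> R ->
  ('C(n, s))%:R * (('C(n, 3 * s))%:R *
     ((i + 6)%:R * (6 * s%:R / n%:R) ^+ (i + 5)) ^+ s)
  <= 6 / n%:R * 2^-1 ^+ s :> R.
Proof.
move=> s0 sn hi; have n0 : (0 < n)%N by lia.
set r : R := 6 * s%:R / n%:R.
have sR : 0 < s%:R :> R by rewrite ltr0n.
have nR : 0 < n%:R :> R by rewrite ltr0n.
have r0 : 0 < r by rewrite /r divr_gt0 // mulr_gt0.
have r2 : r <= 2^-1.
  have : (12 * s)%:R <= n%:R :> R by rewrite ler_nat.
  rewrite natrM => h; rewrite /r ler_pdivrMr //; lra.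
have E1 : 4 * n%:R / s%:R = 24 / r by rewrite /r; field; rewrite !gt_eqF.
have E2 : 4 * n%:R / (3 * s)%:R = 8 / r.
  by rewrite /r natrM; field; rewrite !gt_eqF.
have h1 := bin_le_div_exp R n s0; rewrite E1 in h1.
have h2 : ('C(n, 3 * s))%:R <= (4 * n%:R / (3 * s)%:R) ^+ (3 * s) :> R.
  by apply: bin_le_div_exp; rewrite muln_gt0.
rewrite E2 exprM in h2.
have q0 : 0 <= ((i + 6)%:R * r ^+ (i + 5)) ^+ s :> R.
  by rewrite exprn_ge0 // mulr_ge0 // exprn_ge0 // ltW.
apply: le_trans (_ : (24 / r) ^+ s * (((8 / r) ^+ 3) ^+ s *
   ((i + 6)%:R * r ^+ (i + 5)) ^+ s) <= _).
  by apply: ler_pM => //; [rewrite mulr_ge0 | apply: ler_wpM2r].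
rewrite -!exprMn.
have -> : 24 / r * ((8 / r) ^+ 3 * ((i + 6)%:R * r ^+ (i + 5)))
   = r * (24 * 8 ^+ 3 * (i + 6)%:R * r ^+ i).
  by rewrite exprD; field; rewrite gt_eqF.
have hq : 24 * 8 ^+ 3 * (i + 6)%:R * r ^+ i <= 1 / 4.
  apply: le_trans hi; rewrite ler_wpM2l ?mulr_ge0 //.
  by rewrite lerXn2r // nnegrE ?invr_ge0 // ltW.
apply: le_trans (_ : (r * (1 / 4)) ^+ s <= _).
  have ri0 : 0 <= r ^+ i by rewrite exprn_ge0 // ltW.
  apply: lerXn2r; rewrite ?nnegrE.
  - by apply: mulr_ge0 (ltW r0) (mulr_ge0 (mulr_ge0 _ _) ri0); rewrite // mulr_ge0 ?exprn_ge0.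
  - by rewrite mulr_ge0 ?(ltW r0) // divr_ge0.
  - by rewrite ler_wpM2l ?(ltW r0).
have s2 : s%:R <= 2 ^+ s :> R by rewrite -natrX ler_nat ltnW // ltn_expl.
have rs : r ^+ s <= r.
  by rewrite ler_iXnr ?(ltW r0) //; apply: le_trans r2 _; lra.
rewrite exprMn; apply: le_trans (_ : r * (1 / 4) ^+ s <= _).
  by rewrite ler_wpM2r // exprn_ge0 // divr_ge0.
have -> : (1 / 4 : R) = 2^-1 * 2^-1 by field.
rewrite exprMn mulrA ler_wpM2r ?exprn_ge0 ?invr_ge0 //.
have -> : r * 2^-1 ^+ s = 6 / n%:R * (s%:R * 2^-1 ^+ s) by rewrite /r; ring.
rewrite ler_piMr ?divr_ge0 //.
by rewrite exprVn ler_pdivrMr ?exprn_gt0 // mul1r.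
Qed.

Lemma expf_inv2_mul_exp2 (R : realFieldType) (n : nat) :
  (2 ^ n)%:R * (2^-1) ^+ n = 1 :> R.
Proof. by rewrite natrX -exprMn mulfV ?pnatr_eq0 // expr1n. Qed.

(** * Expansion of random choices *)

Lemma card_bigcup_le (R : realFieldType) (I T : finType) (P : pred I)
    (B : I -> {set T}) :
  #|\bigcup_(i | P i) B i|%:R <= \sum_(i | P i) #|B i|%:R :> R.
Proof.
elim/big_rec2: _ => [|i x A _ IH]; first by rewrite cards0.
apply: le_trans (_ : (#|B i| + #|A|)%:R <= _).
  by rewrite ler_nat leq_card_setU.
by rewrite natrD lerD2l.
Qed.

(** Union bound. Small sets contribute [6/n] through a geometric series; the at most [2^n] medium
    sets fail with probability at most [2^(-2n)] each, contributing [2^-n <= 1/n]. *)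
Theorem card_not_spreading (R : realFieldType) (V : finType)
    (N : V -> {set V}) (i : nat) (g : R) :
  0 <= g -> g <= 1 -> (0 < #|V|)%N ->
  (forall v, #|V|%:R / 2 <= g * #|N v|%:R) ->
  24 * 8 ^+ 3 * (i + 6)%:R * 2^-1 ^+ i <= 1 / 4 :> R ->
  (i + 6)%:R * g ^+ (i + 5) <= 2^-1 ^+ 24 ->
  #|[set c in ffam (fun v => ksets (N v) (i + 6)) | ~~ spreading 1 c]|%:R
    <= 7 / #|V|%:R * #|ffam (fun v => ksets (N v) (i + 6))|%:R :> R.
Proof.
move=> g0 g1 n0 hN hi hg; set n := #|V|; set F := ffam _.
have nR : 0 < n%:R :> R by rewrite ltr0n.
pose bad S T := [set c in F | ~~ spread 1 c S T].
pose I1 (S : {set V}) := (0 < #|S|)%N && (12 * #|S| <= n)%N.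
pose I2 (S : {set V}) := (n < 12 * #|S|)%N && (2 * #|S| <= n)%N.
have cover : [set c in F | ~~ spreading 1 c] \subset
   (\bigcup_(S | I1 S) \bigcup_(T : {set V} | #|T| == (3 * #|S|)%N) bad S T)
     :|: \bigcup_(S | I2 S) bad S S.
  apply/subsetP => c /setIdP[cF /forallPn[S]].
  rewrite negb_imply => /andP[S0]; case: ifP => [sS|sS].
    case/forallPn => T; rewrite negb_imply => /andP[TS nsp].
    (* Enlarging [T] keeps the failure, so only sets of size exactly [3 * #|S|] need to be
       counted. *)
    have [|T' TT' T'S] := exists_superset_card TS; first by lia.
    apply/setUP; left; apply/bigcupP; exists S; first by rewrite /I1 card_gt0 S0.
    apply/bigcupP; exists T'; first exact/eqP.
    rewrite inE cF; apply: contra nsp => /exists_inP[v vS lt1].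
    apply/exists_inP; exists v => //; apply: leq_trans lt1 _.
    by apply/subset_leq_card/setDS.
  rewrite negb_imply => /andP[S2 nsp]; apply/setUP; right.
  apply/bigcupP; exists S; first by rewrite /I2 ltnNge sS.
  by rewrite inE cF.
apply: le_trans (_ : (\sum_(S | I1 S) \sum_(T : {set V} | #|T| == (3 * #|S|)%N)
    #|bad S T|%:R) + \sum_(S | I2 S) #|bad S S|%:R <= _).
  apply: le_trans (_ : (#|\bigcup_(S | I1 S) \bigcup_(T : {set V} | #|T| == (3 * #|S|)%N) bad S T|
     + #|\bigcup_(S | I2 S) bad S S|)%:R <= _).
    rewrite ler_nat; apply: leq_trans (subset_leq_card cover) _.
    exact: leq_card_setU.
  rewrite natrD; apply: lerD; last exact: card_bigcup_le.
  by apply: le_trans (card_bigcup_le _ _ _) _; apply: ler_sum => S _; exact: card_bigcup_le.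
have -> : 7 / n%:R * #|F|%:R = 6 / n%:R * #|F|%:R + 1 / n%:R * #|F|%:R :> R.
  by ring.
pose a (s : nat) : R := ('C(n, 3 * s))%:R *
     ((i + 6)%:R * (6 * s%:R / n%:R) ^+ (i + 5)) ^+ s.
apply: lerD.
  apply: le_trans (_ : (\sum_(S | I1 S) a #|S|) * #|F|%:R <= _); last first.
    apply: ler_wpM2r => //; apply: sum_small_sets => [|s s0 sn|s s0 sn].
    - by rewrite divr_ge0.
    - by rewrite mulr_ge0 // exprn_ge0 // mulr_ge0 // exprn_ge0 // divr_ge0 // mulr_ge0.
    - exact: small_spread_term.
  rewrite mulr_suml; apply: ler_sum => S /andP[S0 Sn].
  rewrite /a; set q := (_ ^+ #|S|).
  rewrite -(card_draws V (3 * #|S|)) mulr_natl -sumr_const mulr_suml.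
  rewrite [leRHS](eq_bigl (fun T : {set V} => #|T| == (3 * #|S|)%N)); last first.
    by move=> T; rewrite inE.
  apply: ler_sum => T /eqP cT.
  have SnR : (12 * #|S|)%:R <= n%:R :> R by rewrite ler_nat.
  rewrite natrM in SnR; have S0R : 0 <= #|S|%:R :> R by [].
  rewrite {}/q /bad /F (_ : i + 6 = (i + 5).+1)%N; last by rewrite addnS.
  apply: card_not_spread.
  - by rewrite divr_ge0 // mulr_ge0.
  - by rewrite ler_pdivrMr // mul1r; apply: le_trans SnR; rewrite ler_wpM2r // ler_nat.
  - move=> v; rewrite cT natrM mulrAC ler_pdivlMr //.
    have hv : n%:R / 2 <= #|N v|%:R :> R.
      by apply: le_trans (hN v) _; rewrite ler_piMl.
    have : #|S|%:R * (n%:R / 2) <= #|S|%:R * #|N v|%:R :> R by rewrite ler_wpM2l.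
    lra.
apply: le_trans (_ : \sum_(S : {set V}) 2^-1 ^+ (2 * n) * #|F|%:R <= _).
  rewrite big_mkcond /=; apply: ler_sum => S _; case: ifP => [/andP[S1 S2]|_].
    have S2R : (2 * #|S|)%:R <= n%:R :> R by rewrite ler_nat.
    rewrite natrM in S2R.
    apply: le_trans (_ : ((i + 5).+1%:R * g ^+ (i + 5)) ^+ #|S| * #|F|%:R <= _).
      rewrite /bad /F (_ : i + 6 = (i + 5).+1)%N; last by rewrite addnS.
      apply: card_not_spread => // v; apply: le_trans (hN v).
      by rewrite ler_pdivlMr // mulrC.
    rewrite ler_wpM2r // -addnS.
    apply: le_trans (_ : (2^-1 ^+ 24) ^+ #|S| <= _).
      by rewrite lerXn2r // nnegrE ?exprn_ge0 ?invr_ge0 // mulr_ge0 // exprn_ge0.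
    (* As [12 * #|S|] exceeds [n], the exponent [24 * #|S|] is at least [2 * n]. *)
    rewrite -exprM ler_wiXn2l ?invr_ge0 //; first by rewrite invf_le1 // ler1n.
    by rewrite (_ : 24 = 2 * 12)%N // -mulnA leq_mul2l ltnW.
  by rewrite mulr_ge0 // exprn_ge0 ?invr_ge0.
rewrite -mulr_suml ler_wpM2r // sumr_const.
have -> : #|{: {set V}}| = (2 ^ n)%N.
  by rewrite -cardsT -powersetT card_powerset cardsT.
rewrite -[_ *+ (2 ^ n)]mulr_natl mul2n -addnn exprD mulrA expf_inv2_mul_exp2 mul1r.
rewrite exprVn div1r lef_pV2 ?posrE ?exprn_gt0 //.
by rewrite -natrX ler_nat ltnW // ltn_expl.
Qed.

(** * Choices avoiding prescribed coincidences *)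

(** Double counting: each [x] in [A] has at least [h] of its [2h] partners outside [A], giving [h^2]
    pairs. Columns with fewer than [b] entries hold at most half of these, and every other column
    holds at most [h]. *)
Lemma many_columns (V : finType) (E : rel V) (A : {set V}) (h b : nat) :
  #|A| = h -> (2 * (#|V| * b) <= h * h)%N ->
  (forall x, x \in A -> (2 * h <= #|[set y | E x y]|)%N) ->
  (h <= 2 * #|[set y in ~: A | (b <= #|[set x in A | E x y]|)%N]|)%N.
Proof.
move=> cA hb hE; set Y := [set y in _ | _].
have [->//|h0] := posnP h.
have low : (h * h <= \sum_(x in A) #|[set y in ~: A | E x y]|)%N.
  rewrite -[X in (X * _)%N]cA -sum_nat_const; apply: leq_sum => x xA.
  have := hE x xA; rewrite -(cardsID A) => h2.
  have h3 : (#|[set y | E x y] :&: A| <= h)%N by rewrite -cA subset_leq_card ?subsetIr.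
  have -> : [set y in ~: A | E x y] = [set y | E x y] :\: A.
    by apply/setP => y; rewrite !inE.
  by lia.
have swap : (\sum_(x in A) #|[set y in ~: A | E x y]|
    = \sum_(y in ~: A) #|[set x in A | E x y]|)%N.
  transitivity (\sum_(x in A) \sum_(y in ~: A | E x y) 1)%N.
    by apply: eq_bigr => x _; rewrite -sum1_card; apply: eq_bigl => y; rewrite !inE.
  rewrite (exchange_big_dep (mem (~: A))) /=; last by move=> x y _ /andP[].
  apply: eq_bigr => y yA; rewrite -sum1_card; apply: eq_bigl => x; rewrite !inE.
  by rewrite inE in yA; rewrite yA.
have upp : (\sum_(y in ~: A) #|[set x in A | E x y]| <= #|Y| * h + #|V| * b)%N.
  rewrite -!sum_nat_const [X in (X + _)%N]big_mkcond -big_split /= big_mkcond /=.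
  apply: leq_sum => y _; case: ifP => // yA; rewrite inE yA /=.
  have : (#|[set x in A | E x y]| <= h)%N.
    by rewrite -cA; apply/subset_leq_card/subsetP => x /setIdP[].
  by move: #|_| => z; case: ifP => ? ?; lia.
rewrite -(leq_pmul2r h0); move: low upp; rewrite swap.
move: (\sum_(y in _) _)%N => s; move: #|Y| => u; nia.
Qed.

(* With [B f v] the values forbidden to [f v] by the choices in [A1], either some
   [B f v] fits into a set [T] of size [t], or every [f v] avoids at least [t]
   values; the choices in [A1] and in [Y] are independent. *)
Theorem card_avoiding (R : realFieldType) (V : finType) (D : V -> {set V})
    (E : rel V) (sigma : V -> V -> V -> V) (A : {set V}) (delta : R)
    (h b t y : nat) :
  0 < delta -> delta <= 1 -> (0 < #|V|)%N ->
  (forall v, (1 / 2 + delta) * #|V|%:R <= #|D v|%:R) ->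
  (forall u v, E u v -> injective (sigma u v)) ->
  (h <= #|A|)%N -> (forall u, u \in A -> (2 * h <= #|[set v | E u v]|)%N) ->
  (2 * (#|V| * b) <= h * h)%N -> t%:R <= delta * #|V|%:R -> (2 * y <= h)%N ->
  #|[set f in ffam D | [forall u, forall v, E u v ==> (f v != sigma u v (f u))]]|%:R
    <= (#|V|%:R * ('C(#|V|, t))%:R * (1 - delta) ^+ b + (1 - t%:R / #|V|%:R) ^+ y)
       * #|ffam D|%:R :> R.
Proof.
move=> d0 d1 n0 hD sinj hA hE hb ht hy; set n := #|V| in n0 hD hb ht *.
have nR : 0 < n%:R :> R by rewrite ltr0n.
(* [A1] has exactly [h] elements and [Y] is disjoint from it, so the values of [f] on [Y] are
   independent of the forbidden sets [B f v], which read [f] on [A1] only. *)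
have [A1 A1A cA1] := exists_subset_card hA.
pose X v := [set u in A1 | E u v].
pose Y := [set v in ~: A1 | (b <= #|X v|)%N].
have cY : (h <= 2 * #|Y|)%N.
  by apply: many_columns => // u /(subsetP A1A); exact: hE.
pose B (f : {ffun V -> V}) v := [set z in D v | [exists u in X v, z == sigma u v (f u)]].
pose Q (f : {ffun V -> V}) := [forall v in Y, (t <= #|B f v|)%N].
pose F' v (T : {set V}) u := [set z | sigma u v z \in T :|: ~: D v].
have tn : (t <= n)%N.
  by rewrite -(ler_nat R); apply: le_trans ht _; rewrite ler_piMl // ltW.
set Z := [set f in _ | _].
have cover : Z \subset
   (\bigcup_(v in Y) \bigcup_(T : {set V} | #|T| == t)
      [set f in ffam D | [forall u in X v, f u \in F' v T u]])
   :|: [set f in ffam D | Q f && [forall v in Y, f v \in ~: B f v]].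
  apply/subsetP => f /setIdP[fD /forallP av].
  apply/setUP; have [Qf|nQ] := boolP (Q f); [right|left].
    rewrite inE fD Qf /=; apply/forall_inP => v vY; rewrite !inE negb_and.
    apply/orP; right; apply/existsPn => u; rewrite negb_and -implybE.
    apply/implyP; rewrite !inE => /andP[_ uv].
    by have /forallP/(_ v) := av u; rewrite uv.
  case/forall_inPn: nQ => v vY; rewrite -ltnNge => /ltnW cB.
  have [T BT cT] := exists_superset_card cB tn.
  apply/bigcupP; exists v => //; apply/bigcupP; exists T; first exact/eqP.
  rewrite inE fD; apply/forall_inP => u uX; rewrite !inE.
  case: (boolP (_ \in D v)) => /= fDv; rewrite ?orbT // orbF.
  apply: (subsetP BT); rewrite inE fDv; apply/exists_inP; by exists u.
apply: le_trans (_ : (#|\bigcup_(v in Y) \bigcup_(T : {set V} | #|T| == t)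
      [set f in ffam D | [forall u in X v, f u \in F' v T u]]| +
      #|[set f in ffam D | Q f && [forall v in Y, f v \in ~: B f v]]|)%:R <= _).
  rewrite ler_nat; apply: leq_trans (subset_leq_card cover) _.
  exact: leq_card_setU.
rewrite natrD mulrDl; apply: lerD.
  apply: le_trans (card_bigcup_le _ _ _) _.
  apply: le_trans (_ : \sum_(v : V) 'C(n, t)%:R * (1 - delta) ^+ b * #|ffam D|%:R <= _).
    rewrite big_mkcond /=; apply: ler_sum => v _; case: ifP => [vY|_]; last first.
      by rewrite !mulr_ge0 // exprn_ge0 // subr_ge0.
    apply: le_trans (card_bigcup_le _ _ _) _.
    rewrite -(card_draws V t) mulr_natl -sumr_const mulr_suml.
    rewrite [leRHS](eq_bigl (fun T : {set V} => #|T| == t)); last first.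
      by move=> T; rewrite inE.
    apply: ler_sum => T /eqP cT.
    have q0 : 0 <= 1 - delta by rewrite subr_ge0.
    apply: le_trans (card_ffam_restrict q0 _) _; last first.
      apply: ler_wpM2r => //; apply: ler_wiXn2l => //; first by rewrite gerBl ltW.
      by move: vY; rewrite inE => /andP[].
    move=> u; rewrite inE => /andP[_ Euv].
    have inj := sinj _ _ Euv.
    (* By injectivity, the image of [D u] meets [D v] in at least [2 * delta * n] values; at most
       [t <= delta * n] of them lie in [T]. The others exclude a fraction [delta] of the choices for
       [f u]. *)
    have cD : (#|D u| + #|D v| <= n + (t + #|D u :\: F' v T u|))%N.
      rewrite -(card_imset (D u) inj) -cT.
      rewrite -(cardsUI (sigma u v @: D u) (D v)); apply: leq_add.
        exact: max_card.
      rewrite -(card_imset (D u :\: F' v T u) inj).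
      apply: leq_trans (leq_card_setU T (sigma u v @: (D u :\: F' v T u))).
      apply/subset_leq_card/subsetP => z /setIP[/imsetP[w wD ->] zD].
      rewrite inE; case: (boolP (_ \in T)) => //= zT.
      by rewrite imset_f // !inE wD zD orbF zT.
    have cD2 : #|D u|%:R + #|D v|%:R <= n%:R + (t%:R + #|D u :\: F' v T u|%:R) :> R.
      by rewrite -!natrD ler_nat.
    have cS : #|D u|%:R = #|D u :&: F' v T u|%:R + #|D u :\: F' v T u|%:R :> R.
      by rewrite -natrD cardsID.
    have cDn : #|D u|%:R <= n%:R :> R by rewrite ler_nat max_card.
    have hDu := hD u; have hDv := hD v.
    have : delta * #|D u|%:R <= delta * n%:R by rewrite ler_wpM2l // ltW.
    lra.
  by rewrite sumr_const -[_ *+ _]mulr_natl !mulrA.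
have q0 : 0 <= 1 - t%:R / n%:R :> R.
  by rewrite subr_ge0 ler_pdivrMr // mul1r ler_nat.
apply: le_trans (card_ffam_adapted (S := Y) (F' := fun f v => ~: B f v) q0 _ _) _.
- move=> f g fg v; congr (~: _); apply/setP => z; rewrite !inE; congr (_ && _).
  apply: eq_existsb => u; rewrite !inE; case: (boolP (u \in A1)) => //= uA1.
  by rewrite fg // !inE uA1.
- move=> f v Qf vY.
  have BD : B f v \subset D v by apply/subsetP => z /setIdP[].
  rewrite -setDE cardsD (setIidPr BD) natrB ?subset_leq_card //.
  rewrite mulrBl mul1r lerD2l lerN2.
  have tB : t%:R <= #|B f v|%:R :> R by rewrite ler_nat; exact: (forall_inP Qf).
  apply: le_trans tB; rewrite mulrAC ler_pdivrMr // ler_wpM2l //.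
  by rewrite ler_nat max_card.
- apply: ler_wpM2r => //; apply: ler_wiXn2l => //; first by rewrite gerBl divr_ge0.
  by move: (cY) hy; lia.
Qed.

(** * Posa rotations *)

Lemma sorted_flip (T : eqType) (r : rel T) (a b : seq T) (w z : T) :
  symmetric r ->
  sorted r (a ++ w :: rev (z :: b))
    = [&& sorted r (rcons a w), r w (last z b) & sorted r (z :: b)].
Proof.
move=> rsym; rewrite sorted_cat_cons; congr (_ && _).
have -> : sorted r (z :: b) = sorted r (rev (z :: b)).
  by rewrite rev_sorted; apply: eq_sorted => u v; rewrite rsym.
case/lastP: b => [|b y] /=; first by rewrite /rev /= andbT.
by rewrite last_rcons -rcons_cons rev_rcons.
Qed.

Lemma next_split (T : eqType) (a b : seq T) (w z : T) :
  uniq (a ++ w :: z :: b) -> next (a ++ w :: z :: b) w = z.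
Proof.
rewrite cat_uniq /= => /and3P[_ /norP[wa _] _].
rewrite next_nth mem_cat inE eqxx orbT index_cat (negPf wa) /= eqxx addn0.
by case: a wa => [|x a] //= _; rewrite nth_cat ltnNge leqnSn /= subSnn.
Qed.

(* [sorted (off_edge u w) p] says that the path [p] does not use the edge [uw];
   phrased this way, it is preserved by the same lemmas as being a path. *)
Definition off_edge (T : eqType) (u w : T) : rel T :=
  fun a b => ~~ ((a == u) && (b == w) || (a == w) && (b == u)).

Lemma off_edge_sym (T : eqType) (u w : T) : symmetric (off_edge u w).
Proof. by move=> a b; rewrite /off_edge orbC andbC [X in _ || X]andbC. Qed.

Lemma off_edge_sorted (T : eqType) (u w : T) (s : seq T) :
  w \notin s -> sorted (off_edge u w) s.
Proof.
elim: s => [|x [|y s] IH] //=; rewrite inE => /norP[xw ws].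
have yw : y != w by apply: contraNneq ws => ->; rewrite inE eqxx.
by rewrite (IH ws : path _ _ _) /off_edge (negPf yw) [x == w]eq_sym (negPf xw) andbF.
Qed.

(** The only neighbours of [w] on this path are [z] and the last entry of [a]. The default [l] is
    never read when [a] is nonempty. *)
Lemma off_edge_split (T : eqType) (u w z l : T) (a b : seq T) :
  uniq (a ++ w :: z :: b) -> z != u -> (a = [::] \/ last l a != u) ->
  sorted (off_edge u w) (a ++ w :: z :: b).
Proof.
rewrite cat_uniq => /and3P[ua /norP[wa _] /= /and3P[wzb _ _]] zu hl.
have pzb : path (off_edge u w) z b := off_edge_sorted u wzb.
rewrite sorted_cat_cons /= pzb andbT.
have zw : z != w by apply: contraNneq wzb => ->; rewrite inE eqxx.
rewrite {2}/off_edge eqxx (negPf zu) (negPf zw) andbF /= andbT.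
case/lastP: a ua wa hl => [|a x] //= _; rewrite mem_rcons inE => /norP[wx wa].
rewrite last_rcons => -[/(congr1 size)|xu]; first by rewrite size_rcons.
rewrite -cats1 -cats1 -catA /= sorted_cat_cons /= andbT.
rewrite off_edge_sorted ?mem_rcons ?inE ?(negPf wx) //=.
by rewrite /off_edge (negPf xu) eq_sym (negPf wx).
Qed.

Lemma off_edge_not_sorted (T : eqType) (u w : T) (a b : seq T) :
  ~~ sorted (off_edge u w) (a ++ u :: w :: b).
Proof. by rewrite sorted_cat_cons /= /off_edge !eqxx /= andbF. Qed.

Section Rotation.
Variables (T : finType) (r : rel T).

Definition is_path (p : seq T) := uniq p && sorted r p.

(** Rotations fix the first vertex: the chord from the last vertex to [w] replaces the edge [wz],
    and [z] becomes the last vertex. *)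
Inductive rotated (p : seq T) : seq T -> Prop :=
| rotated_refl : rotated p p
| rotated_step a w z b : rotated p (a ++ w :: z :: b) -> r (last z b) w ->
    rotated p (a ++ w :: rev (z :: b)).

Definition rotation_ends (x : T) (p : seq T) : {set T} :=
  [set y | `[< exists2 q, rotated p q & last x q = y >]].

Lemma rotation_endsP x p q : rotated p q -> last x q \in rotation_ends x p.
Proof. by move=> pq; rewrite inE; apply/asboolP; exists q. Qed.

Hypothesis rsym : symmetric r.

Lemma rotated_path p q : rotated p q -> is_path p ->
  [/\ is_path q, perm_eq q p & forall x, head x q = head x p].
Proof.
elim=> [//|a w z b _ IH rw] /IH[/andP[uq sq] pq hq].
have pe : perm_eq (a ++ w :: rev (z :: b)) (a ++ w :: z :: b).
  by rewrite perm_cat2l perm_cons perm_rev.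
split; last by move=> x; rewrite -hq; case: (a).
- rewrite /is_path (perm_uniq pe) uq sorted_flip // rsym rw /=.
  by move: sq; rewrite sorted_cat_cons /= => /and3P[-> _ ->].
- exact: perm_trans pe pq.
Qed.

(* Every rotation deletes an edge at the endpoint that it creates. *)
Lemma rotated_off_edge x p q u t :
  rotated p q -> u \notin rotation_ends x p -> t \notin rotation_ends x p ->
  sorted (off_edge u t) q -> sorted (off_edge u t) p.
Proof.
move=> pq uE tE; elim: pq => [//|a w z b pq IH rw].
rewrite sorted_flip; last exact: off_edge_sym.
case/and3P=> sa _ sb; apply: IH; rewrite sorted_cat_cons sa /=.
rewrite (sb : path _ _ _) andbT.
have zE : z \in rotation_ends x p.
  have := rotation_endsP x (rotated_step pq rw).
  by rewrite rev_cons last_cat /= last_rcons.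
rewrite /off_edge negb_or !negb_and.
apply/andP; split; apply/orP; right.
  by apply: contraNneq tE => <-.
by apply: contraNneq uE => <-.
Qed.

(** If [w] and its neighbours on [p] were all outside the set of endpoints, no rotation could have
    deleted the edges of [p] at [w], so [q] would still contain them. But rotating [q] at [w] makes
    the successor of [w] on [q] an endpoint, so both edges would have to lead to the predecessor of
    [w] on [q]. *)
Lemma posa_neighbours x p y w :
  is_path p -> (forall q, is_path q -> (size q <= size p)%N) ->
  y \in rotation_ends x p -> r y w -> p != [::] ->
  w \in rotation_ends x p :|: next p @: rotation_ends x p
          :|: prev p @: rotation_ends x p.
Proof.
move=> pp pmax; rewrite [in X in X -> _]inE => /asboolP[q pq lq] ryw p0.
set E := rotation_ends x p.
have [qq qp hq] := rotated_path pq pp.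
have [uq sq] := andP qq; have [up sp] := andP pp.
have q0 : q != [::] by rewrite -size_eq0 (perm_size qp) size_eq0.
have wq : w \in q.
  (* Otherwise [q] extends by [w], against the maximality of [p]. *)
  apply: contraT => wq; have : is_path (rcons q w).
    rewrite /is_path rcons_uniq wq uq /=.
    case: q sq lq {pq qq qp hq uq wq} q0 => //= v q sq lq _.
    by rewrite rcons_path sq lq.
  by move/pmax; rewrite size_rcons (perm_size qp) ltnn.
have wp : w \in p by rewrite -(perm_mem qp).
apply: contraT; rewrite !inE -/E => /norP[/norP[wE wn] wv].
have qE : last x q \in E by exact: rotation_endsP.
have {wE} wE : w \notin E by rewrite inE.
have [a [z [b Eq]]] : exists a z b, q = a ++ w :: z :: b.
  case/splitPr: wq lq qE wE {pq qq qp hq uq sq q0} => a [|z b] lq qE wE.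
    by move: qE; rewrite last_cat /= (negPf wE).
  by exists a, z, b.
have zE : z \in E.
  have pq' : rotated p (a ++ w :: rev (z :: b)).
    apply: rotated_step; first by rewrite -Eq.
    by move: lq; rewrite Eq last_cat /= => ->.
  by have := rotation_endsP x pq'; rewrite rev_cons last_cat /= last_rcons.
(* The last vertex of [p] is itself an endpoint, so [w] is not last and its cyclic successor [n2] is
   a genuine one. *)
have [p1 [n2 [p2 Ep]]] : exists p1 n2 p2, p = p1 ++ w :: n2 :: p2.
  have pE : last x p \in E by apply: rotation_endsP; exact: rotated_refl.
  case/splitPr: {-1}_ / wp (erefl p) => p1 [|z' b'] Ep.
    by move: pE; rewrite {1}Ep last_cat /= (negPf wE).
  by exists p1, z', b'.
have nE : next p w = n2 by rewrite Ep next_split -?Ep.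
have n2E : n2 \notin E.
  apply: contra wv => n2E; apply/imsetP; exists n2 => //.
  by rewrite -nE prev_next.
(* A neighbour [u] of [w] on [p] stays its neighbour on [q]; since [z] is an endpoint and [u] is
   not, [u] must precede [w]. *)
have key u : u \notin E -> ~~ sorted (off_edge u w) p -> a <> [::] /\ last x a = u.
  move=> uE npw; have : ~~ sorted (off_edge u w) q.
    by apply: contra npw; exact: (rotated_off_edge pq uE wE).
  rewrite Eq => nq; split; first move=> a0.
    move/negP: nq; apply; apply: (@off_edge_split _ _ _ _ x); rewrite -?Eq //; last by left.
    by apply: contraNneq uE => <-.
  apply/eqP; apply: contraT => la.
  move/negP: nq; case; apply: (@off_edge_split _ _ _ _ x); rewrite -?Eq //; last by right.
  by apply: contraNneq uE => <-.
have [a0 la2] : a <> [::] /\ last x a = n2.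
  apply: key => //; apply: contra (off_edge_not_sorted w n2 p1 p2).
  rewrite -Ep; congr (is_true _); apply: eq_sorted => u v.
  by rewrite /off_edge orbC.
(* If [w] heads [p] it also heads [q], since rotations keep the first vertex; this contradicts [a <>
   [::]]. *)
case/lastP: p1 Ep => [|p1 n1] Ep.
  have := hq x; rewrite Eq Ep /=; case: a a0 {la2 key} Eq => //= v a _ Eq vw.
  by move: uq; rewrite Eq vw /= mem_cat inE eqxx orbT.
have n1w : next p n1 = w.
  by move: up; rewrite Ep cat_rcons => up; rewrite next_split.
have n1E : n1 \notin E.
  by apply: contra wn => n1E; apply/imsetP; exists n1.
have [_ la1] : a <> [::] /\ last x a = n1.
  apply: key => //; rewrite Ep cat_rcons; exact: off_edge_not_sorted.
move: up; rewrite Ep -la1 la2 cat_rcons cat_uniq /= !inE eqxx.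
by rewrite !orbT !andbF.
Qed.

End Rotation.

(** * Longest paths in the graph of a spreading choice *)

Definition choice_rel (V : finType) (c : V -> {set V}) : rel V :=
  fun v w => (w \in c v) || (v \in c w).

Lemma choice_rel_sym (V : finType) (c : V -> {set V}) : symmetric (choice_rel c).
Proof. by move=> v w; rewrite /choice_rel orbC. Qed.

(** By Posa's lemma the endpoints have no neighbour outside themselves and their successors and
    predecessors on [p]. That set has at most three times their number, which a small set cannot
    satisfy under expansion by 3. *)
Lemma rotation_ends_card (V : finType) (c : V -> {set V}) (x : V) (p : seq V) :
  spreading 0 c -> is_path (choice_rel c) p -> p != [::] ->
  (forall q, is_path (choice_rel c) q -> (size q <= size p)%N) ->
  (#|V| < 12 * #|rotation_ends (choice_rel c) x p|)%N.
Proof.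
move=> cs pp p0 pmax; set E := rotation_ends _ _ _.
rewrite ltnNge; apply/negP => E12.
have E0 : E != set0.
  by apply/set0Pn; exists (last x p); apply: rotation_endsP; exact: rotated_refl.
have := implyP (forallP cs E) E0; rewrite E12.
move/forallP/(_ (E :|: next p @: E :|: prev p @: E))/implyP => h.
have /h : (#|E :|: next p @: E :|: prev p @: E| <= 3 * #|E|)%N.
  apply: leq_trans (leq_card_setU _ _) _.
  apply: leq_trans (leq_add (leq_card_setU _ _) (leqnn _)) _.
  have := leq_imset_card (next p) (mem E); have := leq_imset_card (prev p) (mem E).
  by rewrite !mulSn mul0n addn0 => h1 h2; rewrite addnA leq_add // leq_add.
case/exists_inP => v vE /card_gt0P[w /setDP[wv]]; case/negP.
apply: posa_neighbours pp pmax vE _ p0; first exact: choice_rel_sym.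
by rewrite /choice_rel wv.
Qed.

(** The length [l] counts edges, hence the shifts by one against the number of vertices of a
    path. *)
Definition spans (V : finType) (r : rel V) (l : nat) (x y : V) (s : seq V) : bool :=
  [&& uniq (x :: s), path r x s, size s == l & last x s == y].

Definition linked (V : finType) (r : rel V) (l : nat) : rel V :=
  fun x y => [exists s : l.-tuple V, spans r l x y s].

(* [prev] is cyclic and is the identity off the path, which makes [linked_prev] a
   bijection of [V] in its last argument. *)
Definition linked_prev (V : finType) (r : rel V) (l : nat) (x y z : V) : V :=
  if [pick s : l.-tuple V | spans r l x y s] is Some s then prev (x :: s) z else z.

Lemma linkedI (V : finType) (r : rel V) (l : nat) (x y : V) (s : seq V) :
  spans r l x y s -> linked r l x y.
Proof.
by move=> h; have /and4P[_ _ sl _] := h; apply/existsP; exists (Tuple sl).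
Qed.

Lemma linked_prevP (V : finType) (r : rel V) (l : nat) (x y : V) :
  linked r l x y -> exists2 s, spans r l x y s & linked_prev r l x y =1 prev (x :: s).
Proof.
rewrite /linked_prev => /existsP[s0 s0P]; case: pickP => [s sP|/(_ s0)].
  by exists s.
by rewrite s0P.
Qed.

Lemma linked_prev_inj (V : finType) (r : rel V) (l : nat) (x y : V) :
  linked r l x y -> injective (linked_prev r l x y).
Proof.
case/linked_prevP => s /and4P[us _ _ _] E u v; rewrite !E.
exact: (can_inj (next_prev us)).
Qed.

Lemma rotation_ends_linked (V : finType) (r : rel V) (x y : V) (s : seq V) :
  symmetric r -> is_path r (x :: s) -> y \in rotation_ends r x (x :: s) ->
  linked r (size s) x y.
Proof.
move=> rsym xs; rewrite inE => /asboolP[q pq lq].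
have [/andP[uq sq] qp hq] := rotated_path rsym pq xs.
case: q {pq} uq sq qp hq lq => [_ _ /perm_size //|v q uq sq qp hq lq].
have vx : v = x by exact: hq x.
rewrite {v}vx in uq sq qp hq lq.
apply: (@linkedI _ _ _ _ _ q); rewrite /spans uq (sq : path _ _ _) -lq eqxx andbT.
by have := perm_size qp => /= -[->].
Qed.

Lemma linked_sym (V : finType) (r : rel V) (l : nat) :
  symmetric r -> symmetric (linked r l).
Proof.
move=> rsym; suff imp x y : linked r l x y -> linked r l y x.
  by move=> x y; apply/idP/idP; exact: imp.
case/existsP => s /and4P[us ps /eqP sl /eqP ls].
have E : rev (x :: s) = y :: behead (rev (x :: s)).
  rewrite -ls; case/lastP: (val s) => [|s' z] //=.
  by rewrite last_rcons -rcons_cons rev_rcons.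
apply: (@linkedI _ _ _ _ _ (behead (rev (x :: s)))); rewrite /spans -E rev_uniq us.
rewrite size_behead size_rev /= sl eqxx /=.
have : sorted r (rev (x :: s)).
  by rewrite rev_sorted (eq_sorted (e' := r)) // => u v; rewrite rsym.
have : last y (rev (x :: s)) = x by rewrite rev_cons last_rcons.
by rewrite E /= => -> ->; rewrite eqxx.
Qed.

Lemma exists_longest_path (V : finType) (r : rel V) :
  exists2 p, is_path r p & forall q, is_path r q -> (size q <= size p)%N.
Proof.
pose P m := [exists s : m.-tuple V, is_path r s].
have exP : exists m, P m by exists 0%N; apply/existsP; exists [tuple].
have PI q : is_path r q -> P (size q).
  by move=> qp; apply/existsP; exists (in_tuple q).
have ub m : P m -> (m <= #|V|)%N.
  case/existsP => s /andP[us _]; rewrite -(size_tuple s) -(card_uniqP us).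
  exact: max_card.
case: (ex_maxnP exP ub) => m /existsP[s sp] hm.
by exists s => // q /PI /hm; rewrite size_tuple.
Qed.

(** Rotations are used twice: first with [x] fixed to produce many last vertices, then, after
    reversing a path so that it starts at such a vertex, on its other end. *)
Theorem many_linked (V : finType) (c : V -> {set V}) (p : seq V) :
  spreading 0 c -> is_path (choice_rel c) p -> p != [::] ->
  (forall q, is_path (choice_rel c) q -> (size q <= size p)%N) ->
  exists2 A : {set V}, (#|V| < 12 * #|A|)%N &
    forall x, x \in A ->
      (#|V| < 12 * #|[set y | linked (choice_rel c) (size p).-1 x y]|)%N.
Proof.
case: p => // x s cs pp _ pmax; set r := choice_rel c in pp pmax *.
have rsym : symmetric r := choice_rel_sym c.
exists (rotation_ends r x (x :: s)); first exact: rotation_ends_card.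
move=> y /(rotation_ends_linked rsym pp); rewrite (linked_sym _ rsym) /=.
case/existsP => s' /and4P[us ps /eqP ss _].
have pp' : is_path r (y :: s') by rewrite /is_path us.
apply: leq_trans (rotation_ends_card y cs pp' _ _) _ => //.
  by move=> q /pmax; rewrite /= ss.
rewrite leq_mul2l /=; apply/subset_leq_card/subsetP => z.
by move/(rotation_ends_linked rsym pp'); rewrite inE size_tuple.
Qed.

(** Connectivity: either [S] or its complement has at most half of the vertices, so spreading
    applies to one of them. *)
Lemma spreading_crossing (V : finType) (c : V -> {set V}) (S : {set V}) :
  spreading 0 c -> S != set0 -> S != setT ->
  exists v w, [/\ v \in S, w \notin S & choice_rel c v w].
Proof.
move=> cs.
have half (U : {set V}) : U != set0 -> (2 * #|U| <= #|V|)%N ->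
    exists v w, [/\ v \in U, w \notin U & choice_rel c v w].
  move=> U0 U2; have := implyP (forallP cs U) U0.
  have imp : (if (12 * #|U| <= #|V|)%N
     then [forall T : {set V}, (#|T| <= 3 * #|U|)%N ==> spread 0 c U T]
     else (2 * #|U| <= #|V|)%N ==> spread 0 c U U) -> spread 0 c U U.
    case: ifP => _; last by move/implyP; apply.
    by move/forallP/(_ U)/implyP; apply; rewrite leq_pmull.
  move/imp.
  case/exists_inP => v vU /card_gt0P[w /setDP[wv wU]].
  by exists v, w; split => //; rewrite /choice_rel wv.
move=> S0 ST; have [S2|S2] := leqP (2 * #|S|)%N #|V|; first exact: half.
have [||v [w [vS wS vw]]] := half (~: S).
- by rewrite -setCT (inj_eq (@setC_inj V)).
- by have := cardsC S; lia.
exists w, v; rewrite choice_rel_sym; split=> //; first by rewrite inE negbK in wS.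
by rewrite inE in vS.
Qed.

(** The cycle is opened at [v] and [w] is put in front. *)
Lemma cycle_extend (V : finType) (r : rel V) (C : seq V) (v w : V) :
  symmetric r -> uniq C -> cycle r C -> v \in C -> w \notin C -> r v w ->
  exists2 p, is_path r p & size p = (size C).+1.
Proof.
move=> rsym uC cC vC wC vw; have [i s Es] := rot_to vC.
exists (w :: rot i C); last by rewrite /= size_rot.
rewrite /is_path cons_uniq mem_rot wC rot_uniq uC /= Es /= rsym vw /=.
by move: cC; rewrite -(rot_cycle i) Es /= rcons_path => /andP[].
Qed.

(* If [f y] were the predecessor of [f x], the edges [x f(x)] and [y f(y)] would
   close the path into a cycle on the same vertices. *)
Theorem linked_prev_avoided (V : finType) (a c : V -> {set V}) (f : V -> V)
    (l : nat) (x y : V) :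
  spreading 0 a -> (forall v, a v \subset c v) ->
  (forall v, f v \in c v) -> (forall v, f v != v) ->
  (forall q, is_path (choice_rel c) q -> (size q <= l.+1)%N) ->
  (forall C, uniq C -> size C = #|V| -> ~~ cycle (choice_rel c) C) ->
  linked (choice_rel a) l x y ->
  f y != linked_prev (choice_rel a) l x y (f x).
Proof.
move=> sa ac fc fx lmax nham /linked_prevP[s /and4P[us ps /eqP sl /eqP ls]] ->.
set r := choice_rel c in lmax nham *.
have rsym : symmetric r := choice_rel_sym c.
have sub v w : choice_rel a v w -> r v w.
  by case/orP => h; apply/orP; [left|right]; exact: (subsetP (ac _)).
have rf v : r v (f v) by rewrite /r /choice_rel fc.
have sr : sorted r (x :: s) by exact: sub_path ps.
apply/eqP => fy.
have no_long q : is_path r q -> size q <> l.+2.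
  by move=> /lmax + sq; rewrite sq ltnn.
have fxs : f x \in x :: s.
  apply: contraT => fxs; case: (no_long (f x :: x :: s)); last by rewrite /= sl.
  by rewrite /is_path cons_uniq fxs us /= rsym rf.
(* As [f x] differs from the head [x], its cyclic predecessor [u] is a genuine one. *)
have [u [p1 [p2 Es]]] : exists u p1 p2, x :: s = rcons p1 u ++ f x :: p2.
  move: (fxs); rewrite inE (negPf (fx x)) /= => /splitPr[p1 p2].
  case/lastP: p1 => [|p1 u]; first by exists x, [::], p2.
  by exists u, (x :: p1), p2.
have pu : prev (x :: s) (f x) = u.
  have -> : f x = next (x :: s) u.
    by move: us; rewrite Es cat_rcons => us; rewrite next_split.
  by rewrite prev_next.
(* The path runs from [x] to [u], jumps to the end [y] by the edge [y f(y)], and returns backwards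
   to [f x], where [x f(x)] closes it. *)
set C := p1 ++ u :: rev (f x :: p2).
have sC : sorted r C.
  have [s1 s2] := cat_sorted2 (etrans (congr1 _ (esym Es)) sr).
  rewrite sorted_flip // s1 s2 andbT /=.
  have := congr1 (last x) Es; rewrite last_cat /= ls => <-.
  by rewrite -pu -fy rsym rf.
have lC : last x C = f x by rewrite /C rev_cons last_cat /= last_rcons.
have pC : perm_eq C (x :: s).
  by rewrite Es cat_rcons perm_cat2l perm_cons perm_rev.
have uC : uniq C by rewrite (perm_uniq pC).
have [C' EC] : exists C', C = x :: C'.
  by rewrite /C; case: (p1) Es => [|z p] [<- _]; eexists.
have cC : cycle r C.
  rewrite EC /= rcons_path; move: sC lC; rewrite EC /= => -> ->.
  by rewrite rsym rf.
(* A cycle on all vertices is excluded; otherwise connectivity gives an edge leaving the cycle,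
   hence a path that is too long. *)
have [/nham|nV] := eqVneq (size C) #|V|; first by rewrite cC => /(_ uC).
have [||v [w [vC wC avw]]] := @spreading_crossing _ a [set v in C] sa.
- by apply/set0Pn; exists x; rewrite inE EC inE eqxx.
- apply: contra nV => /eqP CT; apply/eqP; rewrite -(card_uniqP uC) -cardsT -CT.
  by apply: eq_card => v; rewrite inE.
rewrite inE in vC; rewrite inE in wC.
have [q qp qs] := cycle_extend rsym uC cC vC wC (sub _ _ avw).
by case: (no_long q qp); rewrite qs (perm_size pC) /= sl.
Qed.

(** * The colouring argument *)

Lemma spreading_remove (V : finType) (c a : V -> {set V}) (f : V -> V) :
  (forall v, a v = c v :\ f v) -> spreading 1 c -> spreading 0 a.
Proof.
move=> ac cs; have imp S T : spread 1 c S T -> spread 0 a S T.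
  case/exists_inP => v vS c1; apply/exists_inP; exists v => //.
  rewrite ac setDDl setUC -setDDl; move: c1.
  by rewrite (cardsD1 (f v)); case: (_ \in _) => /=; lia.
apply/forallP => S; apply/implyP => S0; have := implyP (forallP cs S) S0.
case: ifP => _; last by move=> /implyP h; apply/implyP => /h /imp.
move=> /forallP h; apply/forallP => T; apply/implyP => TS.
by apply: imp; exact: (implyP (h T)).
Qed.

(** An edge of [p] chosen by one of its ends is that end's edge to its successor or predecessor,
    which the deletion spares. *)
Lemma sorted_avoid_next_prev (V : finType) (c a : V -> {set V}) (f : V -> V)
    (p : seq V) :
  (forall v, a v = c v :\ f v) -> is_path (choice_rel c) p ->
  (forall v, f v != next p v) -> (forall v, f v != prev p v) ->
  is_path (choice_rel a) p.
Proof.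
move=> ac /andP[up sp] fn fp; rewrite /is_path up /=.
have step q1 u w q2 : p = q1 ++ u :: w :: q2 -> choice_rel c u w -> choice_rel a u w.
  move=> Ep; have nu : next p u = w by move: up; rewrite Ep => /next_split.
  have pw : prev p w = u by rewrite -nu prev_next.
  have := fn u; have := fp w; rewrite nu pw /choice_rel !ac !inE => h1 h2.
  by rewrite eq_sym h2 [u == _]eq_sym h1.
have gen q1 q2 : p = q1 ++ q2 -> sorted (choice_rel a) q2.
  elim: q2 q1 => [|u [|w q2] IH] q1 Ep //=.
  have cuw : choice_rel c u w.
    by move: sp; rewrite Ep sorted_cat_cons /= => /and3P[].
  rewrite (step q1 u w q2 Ep cuw) /=.
  by apply: (IH (rcons q1 u)); rewrite cat_rcons.
exact: (gen [::]).
Qed.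

(** Here each vertex has [k.+1] choices, and a pair [(c, f)] is sent to [(a, f)] with
    [a v = c v :\ f v]. Each bad [c] admits at least [k.-1 ^ #|V|] deletions that keep a fixed
    longest path, while [card_avoiding] bounds the possible [f] for each [a]. *)
Theorem card_spreading_nonham (R : realFieldType) (V : finType)
    (N : V -> {set V}) (ham : pred {ffun V -> {set V}}) (k : nat) (delta : R)
    (h b t y : nat) :
  (forall v, v \notin N v) ->
  (forall c : {ffun V -> {set V}}, ~~ ham c ->
    forall C, uniq C -> size C = #|V| -> ~~ cycle (choice_rel c) C) ->
  0 < delta -> delta <= 1 -> (0 < #|V|)%N ->
  (forall v, (1 / 2 + delta) * #|V|%:R + k%:R <= #|N v|%:R) ->
  (24 * h <= #|V|)%N -> (2 * (#|V| * b) <= h * h)%N ->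
  t%:R <= delta * #|V|%:R -> (2 * y <= h)%N ->
  #|[set c in ffam (fun v => ksets (N v) k.+1) | spreading 1 c && ~~ ham c]|%:R
    * (k.-1)%:R ^+ #|V|
  <= (#|V|%:R * ('C(#|V|, t))%:R * (1 - delta) ^+ b + (1 - t%:R / #|V|%:R) ^+ y)
     * (k.+1%:R ^+ #|V| * #|ffam (fun v => ksets (N v) k.+1)|%:R) :> R.
Proof.
move=> Nirr hham d0 d1 n0 hN h24 hb ht hy.
set rho := (_ + _ ^+ y : R); set bad := [set c in _ | _].
have tn : t%:R / #|V|%:R <= 1 :> R.
  by rewrite ler_pdivrMr ?ltr0n // mul1r (le_trans ht) // ler_piMl.
have rho0 : 0 <= rho.
  by rewrite addr_ge0 ?mulr_ge0 ?exprn_ge0 ?subr_ge0.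
pose lp (c : {ffun V -> {set V}}) := s2val (cid2 (exists_longest_path (choice_rel c))).
have lpP (c : {ffun V -> {set V}}) : is_path (choice_rel c) (lp c) /\
    forall q, is_path (choice_rel c) q -> (size q <= size (lp c))%N.
  by rewrite /lp; case: cid2.
clearbody lp.
have lp0 c : (0 < size (lp c))%N.
  case/card_gt0P: n0 => x _; exact: ((lpP c).2 [:: x]).
pose X (c : {ffun V -> {set V}}) v := c v :\: [set next (lp c) v; prev (lp c) v].
pose W := [set cf : {ffun V -> {set V}} * {ffun V -> V} |
             (cf.1 \in bad) && (cf.2 \in ffam (X cf.1))].
pose avoid (a : {ffun V -> {set V}}) := [set f in ffam (fun v => N v :\: a v) |
   [forall u, forall v, linked (choice_rel a) (size (lp a)).-1 u v ==>
      (f v != linked_prev (choice_rel a) (size (lp a)).-1 u v (f u))]].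
pose good := [set a in ffam (fun v => ksets (N v) k) | spreading 0 a].
pose Z := [set af : {ffun V -> {set V}} * {ffun V -> V} |
             (af.1 \in good) && (af.2 \in avoid af.1)].
have pairs_card (P : {set {ffun V -> {set V}}}) (F : {ffun V -> {set V}} -> {set {ffun V -> V}}) :
    #|[set cf : {ffun V -> {set V}} * {ffun V -> V} | (cf.1 \in P) && (cf.2 \in F cf.1)]|
    = (\sum_(c in P) #|F c|)%N.
  rewrite -sum1_card (eq_bigl (fun cf => (cf.1 \in P) && (cf.2 \in F cf.1))); last first.
    by move=> cf; rewrite inE.
  rewrite -(pair_big_dep (mem P) (fun c f => f \in F c) (fun _ _ => 1%N)) /=.
  by apply: eq_bigr => c _; rewrite sum1_card.
(* Of the [k.+1] choices at a vertex, at most two are its neighbours on the fixed longest path. *)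
have low : (#|bad| * k.-1 ^ #|V| <= #|W|)%N.
  rewrite (pairs_card bad (fun c => ffam (X c))) -sum_nat_const; apply: leq_sum => c.
  rewrite inE => /andP[/ffamP cF _]; rewrite card_ffam -prod_nat_const.
  apply: leq_prod => v _; have := cF v; rewrite inE => /andP[_ /eqP ck].
  rewrite /X -subn1 -subSS -ck -(cardsID [set next (lp c) v; prev (lp c) v] (c v)).
  rewrite leq_subLR leq_add2r; apply: leq_trans (subset_leq_card (subsetIr _ _)) _.
  by rewrite cards2; case: (_ != _).
have WZ : (#|W| <= #|Z|)%N.
  pose phi (cf : {ffun V -> {set V}} * {ffun V -> V}) :=
    ([ffun v => cf.1 v :\ cf.2 v], cf.2).
  (* Adding [f v] back to [a v] recovers [c v]. *)
  have inj : {in W &, injective phi}.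
    move=> [c f] [c' f'] /=; rewrite !inE /= => /andP[_ /forallP cf] /andP[_ /forallP cf'].
    case=> /ffunP E Ef; subst f'; congr (_, _); apply/ffunP => v.
    have := E v; rewrite !ffunE => Ev.
    by rewrite -(@setD1K _ (f v) (c v)) ?Ev ?setD1K //;
      [have := cf' v | have := cf v] => /setDP[].
  rewrite -(card_in_imset inj); apply/subset_leq_card/subsetP => _ /imsetP[[c f] + ->].
  rewrite !inE /= => /andP[/andP[/forallP cF /andP[cs cham]] /forallP cf].
  set a := [ffun v => c v :\ f v].
  have av v : a v = c v :\ f v by rewrite ffunE.
  have fc v : f v \in c v by case/setDP: (cf v).
  have cN v : c v \subset N v by have := cF v; rewrite inE => /andP[].
  have as0 : spreading 0 a := spreading_remove av cs.
  have pa : is_path (choice_rel a) (lp c).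
    apply: (sorted_avoid_next_prev av (lpP c).1) => v; have := cf v.
      by rewrite !inE => /andP[/norP[]].
    by rewrite !inE => /andP[/norP[]].
  have ac v : a v \subset c v by rewrite av subsetDl.
  (* The longest path of [c] survives in [a], whose graph is contained in that of [c]. *)
  have sl : size (lp a) = size (lp c).
    apply/eqP; rewrite eqn_leq (lpP a).2 // andbT; apply: (lpP c).2.
    have /andP[ua sa] := (lpP a).1; rewrite /is_path ua; apply: sub_sorted sa.
    by move=> u v /orP[] z; apply/orP; [left|right]; exact: (subsetP (ac _)).
  rewrite as0 andbT; apply/and3P; split.
  - apply/forallP => v; rewrite inE (subset_trans (ac v) (cN v)) /=.
    have := cF v; rewrite inE => /andP[_].
    by rewrite av (cardsD1 (f v)) fc add1n.
  - by apply/forallP => v; rewrite !inE av !inE eqxx (subsetP (cN v)).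
  - apply/forallP => u; apply/forallP => v; apply/implyP; rewrite sl.
    apply: linked_prev_avoided (hham c cham) => //.
      by move=> w; apply: contraNneq (Nirr w) => E; rewrite -{1}E (subsetP (cN w)).
    by move=> q /(lpP c).2; rewrite prednK.
have upp : #|Z|%:R <= rho * (k.+1%:R ^+ #|V| * #|ffam (fun v => ksets (N v) k.+1)|%:R).
  rewrite (pairs_card good avoid) natr_sum.
  have kN v : (k < #|N v|)%N.
    rewrite -(ltr_nat R); apply: lt_le_trans (hN v); rewrite ltrDr.
    by rewrite mulr_gt0 ?ltr0n // addr_gt0 ?divr_gt0.
  have half (s : nat) : (#|V| < 12 * s -> 2 * h <= s)%N.
    move=> /(leq_ltn_trans h24).
    by rewrite (_ : 24 = 12 * 2)%N // -mulnA ltn_pmul2l // => /ltnW.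
  pose q : R := (\prod_v (#|N v| - k)%N)%:R.
  apply: le_trans (_ : \sum_(a in good) rho * q <= _).
    apply: ler_sum => a; rewrite inE => /andP[/ffamP aF as0].
    have aN v : #|N v :\: a v| = (#|N v| - k)%N.
      have := aF v; rewrite inE => /andP[sub /eqP <-].
      by rewrite cardsD (setIidPr sub).
    have lpa : lp a != [::] by rewrite -size_eq0 -lt0n lp0.
    have [A hA hAE] := many_linked as0 (lpP a).1 lpa (lpP a).2.
    have -> : q = #|ffam (fun v => N v :\: a v)|%:R.
      by rewrite card_ffam; congr (_%:R); apply: eq_bigr => v _; rewrite aN.
    apply: (card_avoiding (A := A) (h := h)) => //.
    - by move=> v; rewrite aN natrB ?(ltnW (kN v)) // lerBrDr.
    - by move=> u v; exact: linked_prev_inj.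
    - by apply: leq_trans (half _ hA); rewrite leq_pmull.
    - by move=> u /hAE /half.
  rewrite sumr_const -[leLHS]mulr_natl mulrCA ler_wpM2l //.
  apply: le_trans (_ : #|ffam (fun v => ksets (N v) k)|%:R * q <= _).
    by rewrite ler_wpM2r ?ler0n // ler_nat subset_leq_card //; apply/subsetP => a /setIdP[].
  rewrite !card_ffam -prodr_const /q !natr_prod -!big_split /=.
  (* Both sides count sets of size [k.+1] with a marked element, the deleted choice. *)
  apply: ler_prod => v _; rewrite mulr_ge0 //= !card_ksets -!natrM ler_nat.
  by rewrite mulnC -mul_bin_left.
apply: le_trans upp; apply: le_trans (_ : #|W|%:R <= _); last by rewrite ler_nat.
by rewrite -natrX -natrM ler_nat.
Qed.

(** * Choice of the constants *)

Lemma bernoulli (R : realFieldType) (a : R) (n : nat) :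
  -1 <= a -> 1 + n%:R * a <= (1 + a) ^+ n.
Proof.
move=> a1; elim: n => [|n IH]; first by rewrite mul0r addr0 expr0.
have a0 : 0 <= 1 + a by lra.
rewrite exprS; apply: le_trans (ler_wpM2l a0 IH).
have : 0 <= n%:R * (a * a) by rewrite mulr_ge0 // -expr2 sqr_ge0.
by rewrite -natr1; lra.
Qed.

(** Bernoulli for the exponent [j %/ 3], cubed, makes [q^-1 ^+ j] grow at least like [j^3], which
    beats [j^2]. *)
Lemma sqr_geometric_le1 (R : realType) (C q : R) : 0 <= q -> q < 1 ->
  exists J : nat, forall j, (J <= j)%N -> C * j%:R ^+ 2 * q ^+ j <= 1.
Proof.
move=> q0 q1; have [C0|C0] := leP C 0.
  exists 0%N => j _; apply: le_trans ler01; rewrite mulr_le0_ge0 ?exprn_ge0 //.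
  by rewrite mulr_le0_ge0 ?exprn_ge0.
have [->|qn0] := eqVneq q 0.
  by exists 1%N => -[|j] // _; rewrite expr0n /= mulr0.
have {qn0}q0 : 0 < q by rewrite lt0r qn0.
pose a := q^-1 - 1; have a0 : 0 < a by rewrite subr_gt0 invf_gt1.
have B0 : 0 <= 216 * C / a ^+ 3 by rewrite divr_ge0 ?exprn_ge0 ?mulr_ge0 // ltW.
exists (maxn 3 (Num.bound (216 * C / a ^+ 3))) => j; rewrite geq_max => /andP[j3 jB].
have jR : 0 < j%:R :> R by rewrite ltr0n; lia.
have Ba : 216 * C <= j%:R * a ^+ 3.
  rewrite -ler_pdivrMr ?exprn_gt0 //; apply: le_trans (ltW (archi_boundP B0)) _.
  by rewrite ler_nat.
have low : (j%:R * a / 6) ^+ 3 <= q^-1 ^+ j.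
  apply: le_trans (_ : (q^-1 ^+ (j %/ 3)) ^+ 3 <= _); last first.
    rewrite -exprM ler_weXn2l ?leq_trunc_div //.
    by rewrite invf_ge1 // ltW.
  rewrite lerXn2r ?nnegrE ?exprn_ge0 ?invr_ge0 ?(ltW q0) //.
    by rewrite divr_ge0 // mulr_ge0 // ltW.
  have -> : q^-1 = 1 + a by rewrite /a; ring.
  apply: le_trans (bernoulli _ _); last by lra.
  have : j%:R <= (6 * (j %/ 3))%:R :> R by rewrite ler_nat; lia.
  rewrite natrM => h.
  have : j%:R * a <= 6 * (j %/ 3)%:R * a by rewrite ler_wpM2r // ltW.
  lra.
rewrite -[q]invrK exprVn ler_pdivrMr ?exprn_gt0 ?invr_gt0 // mul1r.
apply: le_trans low.
have -> : (j%:R * a / 6) ^+ 3 = (j%:R * a ^+ 3) * j%:R ^+ 2 / 216 :> R by field.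
rewrite ler_pdivlMr // mulrAC ler_wpM2r ?exprn_ge0 //.
by rewrite mulrC.
Qed.

Lemma exists_many_choices (R : realType) (C g : R) : 0 <= g -> g < 1 -> 0 < C ->
  exists K, forall i, (K <= i)%N -> (i + 6)%:R * g ^+ i <= C.
Proof.
move=> g0 g1 C0; have [J hJ] := sqr_geometric_le1 (7 / C) g0 g1.
exists (maxn 1 J) => i; rewrite geq_max => /andP[i1 iJ].
have := hJ i iJ.
have -> : 7 / C * i%:R ^+ 2 * g ^+ i = (7 * i%:R ^+ 2) * g ^+ i / C by ring.
rewrite ler_pdivrMr // mul1r; apply: le_trans.
by rewrite ler_wpM2r ?exprn_ge0 // -natrX -natrM ler_nat; nia.
Qed.

(* The hypothesis on [m] and [j] absorbs the entropy bound [C(n, t) <= (8 m) ^ t]. *)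
Lemma failure_rate (R : realFieldType) (delta : R) (n j k m t b y : nat) :
  0 < delta -> delta <= 1 -> (0 < m)%N -> (0 < t)%N ->
  (t * m <= n <= 2 * m * t)%N -> (j * t <= b)%N -> (t <= y)%N ->
  32 * m%:R ^+ 2 * (1 - delta) ^+ j <= 1 / 2 :> R -> (16 * m ^ 2 < k)%N ->
  n%:R * ('C(n, t))%:R * (1 - delta) ^+ b + (1 - t%:R / n%:R) ^+ y
  <= 2 * (1 - 1 / (4 * m%:R)) ^+ t * (1 - 2 / k%:R) ^+ n :> R.
Proof.
move=> d0 d1 m0 t0 /andP[tmn ntm] jtb ty hj hk.
have n0 : (0 < n)%N by apply: leq_trans tmn; rewrite muln_gt0 t0.
have [mR tR nR] : [/\ 1 <= m%:R :> R, 1 <= t%:R :> R & 0 < n%:R :> R].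
  by rewrite !ler1n ltr0n.
have mR0 : 0 < m%:R :> R by apply: lt_le_trans mR.
have tR0 : 0 < t%:R :> R by apply: lt_le_trans tR.
have ntR : n%:R <= 2 * m%:R * t%:R :> R by rewrite -!natrM ler_nat.
have q0 : 0 <= 1 - delta by lra.
have qle1 : 1 - delta <= 1 by lra.
set theta : R := 1 - 1 / (2 * m%:R).
have im : 1 / (2 * m%:R) <= 1 / 2 :> R.
  by rewrite ler_pdivrMr ?mulr_gt0 //; lra.
have im0 : 0 <= 1 / (2 * m%:R) :> R by rewrite divr_ge0 // mulr_ge0.
have th0 : 1 / 2 <= theta by rewrite /theta; lra.
have th1 : theta <= 1 by rewrite /theta; lra.
(* The factors [n], ['C(n, t)] and [(1 - delta) ^+ b] are bounded by [t]-th powers of [4m], [8m] and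
   [(1 - delta) ^+ j]; the product of these bases is at most 1/2. *)
have first : n%:R * ('C(n, t))%:R * (1 - delta) ^+ b <= theta ^+ t.
  have hC : ('C(n, t))%:R <= (8 * m%:R) ^+ t :> R.
    apply: le_trans (bin_le_div_exp R n t0) _.
    rewrite lerXn2r ?nnegrE ?divr_ge0 ?mulr_ge0 ?(ltW nR) ?(ltW tR0) ?(ltW mR0) //.
    by rewrite ler_pdivrMr //; lra.
  have hn : n%:R <= (4 * m%:R) ^+ t :> R.
    apply: le_trans ntR _; have -> : 4 * m%:R = (2 * m%:R) * 2 :> R by ring.
    rewrite exprMn; apply: ler_pM; rewrite ?mulr_ge0 ?(ltW mR0) ?(ltW tR0) //.
      by rewrite ler_eXnr //; lra.
    by rewrite -natrX ler_nat ltnW // ltn_expl.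
  have hq : (1 - delta) ^+ b <= ((1 - delta) ^+ j) ^+ t.
    by rewrite -exprM ler_wiXn2l.
  apply: le_trans (_ : (32 * m%:R ^+ 2 * (1 - delta) ^+ j) ^+ t <= _); last first.
    have b0 : 0 <= 32 * m%:R ^+ 2 * (1 - delta) ^+ j.
      by rewrite !mulr_ge0 ?exprn_ge0 ?(ltW mR0).
    by rewrite lerXn2r ?nnegrE //; lra.
  have -> : 32 * m%:R ^+ 2 * (1 - delta) ^+ j
      = (4 * m%:R) * (8 * m%:R) * (1 - delta) ^+ j by ring.
  move: hC hn; set u := 4 * _; set v := 8 * _ => hC hn.
  rewrite exprMn [(u * v) ^+ t]exprMn.
  apply: ler_pM => //; first by rewrite mulr_ge0 ?(ltW nR).
    by rewrite exprn_ge0.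
  by apply: ler_pM => //; exact: ltW.
have second : (1 - t%:R / n%:R) ^+ y <= theta ^+ t.
  have tn : t%:R / n%:R <= 1 :> R.
    rewrite ler_pdivrMr // mul1r ler_nat; apply: leq_trans tmn.
    by rewrite leq_pmulr.
  have mtn : 1 / (2 * m%:R) <= t%:R / n%:R :> R.
    rewrite ler_pdivrMr ?mulr_gt0 // mulrAC ler_pdivlMr //; lra.
  apply: le_trans (_ : theta ^+ y <= _).
    by rewrite lerXn2r ?nnegrE ?subr_ge0 //; rewrite /theta; lra.
  by apply: ler_wiXn2l => //; lra.
have k0 : 0 < k%:R :> R by rewrite ltr0n; apply: leq_ltn_trans hk.
have kR : 16 * m%:R ^+ 2 <= k%:R :> R.
  by rewrite -natrX -natrM ler_nat ltnW.
(* Half of the gain [1/(2m)] is kept as decay. The other half pays for [(1 - 2/k) ^+ (2 * m)], which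
   by Bernoulli is at least [1 - 4m/k >= 1 - 1/(4m)]. *)
have step : theta <= (1 - 1 / (4 * m%:R)) * (1 - 2 / k%:R) ^+ (2 * m).
  have mm : 1 <= m%:R ^+ 2 :> R by rewrite exprn_ege1.
  have i4 : 1 / (4 * m%:R) <= 1 / 4 :> R by rewrite ler_pdivrMr ?mulr_gt0 //; lra.
  have i40 : 0 <= 1 / (4 * m%:R) :> R by rewrite divr_ge0 // mulr_ge0 // ltW.
  have kk : 2 / k%:R <= 1 :> R by rewrite ler_pdivrMr // mul1r; lra.
  have := @bernoulli R (- (2 / k%:R)) (2 * m) _; rewrite lerN2 => /(_ kk) hb.
  apply: le_trans (_ : (1 - 1 / (4 * m%:R)) * (1 + (2 * m)%:R * - (2 / k%:R)) <= _); last first.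
    by apply: ler_wpM2l => //; lra.
  have hkm : (2 * m)%:R * (2 / k%:R) <= 1 / (4 * m%:R) :> R.
    rewrite natrM ler_pdivlMr ?mulr_gt0 //.
    have -> : 2 * m%:R * (2 / k%:R) * (4 * m%:R) = 16 * m%:R ^+ 2 / k%:R :> R by ring.
    by rewrite ler_pdivrMr // mul1r.
  have e4 : theta = 1 - (1 / (4 * m%:R) + 1 / (4 * m%:R)).
    by rewrite /theta; field; rewrite gt_eqF.
  rewrite e4 mulrN; set u := _ * (2 / _) in hkm *; set w := 1 / _ in i40 i4 hkm *.
  have : 0 <= w * (w - u) + w * (1 - w) by rewrite addr_ge0 // mulr_ge0 //; lra.
  nra.
apply: le_trans (lerD first second) _.
have -> : theta ^+ t + theta ^+ t = 2 * theta ^+ t by ring.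
rewrite -mulrA ler_wpM2l //.
have x0 : 0 <= 1 - 2 / k%:R :> R.
  rewrite subr_ge0 ler_pdivrMr // mul1r; apply: le_trans kR.
  have : 1 <= m%:R ^+ 2 :> R by rewrite exprn_ege1.
  lra.
have x1 : 1 - 2 / k%:R <= 1 :> R by rewrite gerBl divr_ge0 // ltW.
apply: le_trans (_ : (1 - 1 / (4 * m%:R)) ^+ t * ((1 - 2 / k%:R) ^+ (2 * m)) ^+ t <= _).
  by rewrite -exprMn lerXn2r // nnegrE; [|apply: le_trans step]; lra.
rewrite -exprM ler_wpM2l ?exprn_ge0 //; last by apply: ler_wiXn2l.
rewrite subr_ge0 ler_pdivrMr ?mulr_gt0 //; lra.
Qed.

(** [delta], [j], [m] and [K] depend on [eps] alone; only [n0] depends on [k] and [eta]. Failed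
    expansion and expanding but non-Hamiltonian choices are each given [eta / 2]. *)
Theorem nonham_rare (R : realType) (eps : R) : 0 < eps -> eps <= 1 ->
  exists K : nat, forall k : nat, (K <= k)%N -> forall eta : R, 0 < eta ->
  exists n0 : nat, forall (V : finType) (N : V -> {set V})
      (ham : pred {ffun V -> {set V}}),
    (n0 <= #|V|)%N -> (forall v, v \notin N v) ->
    (forall c : {ffun V -> {set V}}, ~~ ham c ->
      forall C, uniq C -> size C = #|V| -> ~~ cycle (choice_rel c) C) ->
    (forall v, (1 / 2 + eps) * #|V|%:R <= #|N v|%:R) ->
    #|[set c in ffam (fun v => ksets (N v) k) | ~~ ham c]|%:R
      <= eta * #|ffam (fun v => ksets (N v) k)|%:R.
Proof.
(* Half of [eps] pays for the deleted choices; [g] bounds the share of half the vertices in a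
   neighbourhood. *)
move=> e0 e1; pose delta := eps / 2; pose g : R := (1 + 2 * eps)^-1.
have d0 : 0 < delta by rewrite divr_gt0.
have d1 : delta <= 1 by rewrite /delta; lra.
have g0 : 0 <= g by rewrite invr_ge0; lra.
have g1 : g < 1 by rewrite invf_lt1; lra.
have [||J0 hJ0] := @sqr_geometric_le1 R (64 * (24 * 96)%:R ^+ 2) (1 - delta).
- by rewrite subr_ge0.
- by rewrite gtrBl.
(* [J0] makes [(1 - delta) ^+ j] beat the entropy; [j >= 1 / delta] ensures [t <= delta * n]
   later. *)
pose j := maxn J0 (Num.bound delta^-1).
have dj : 1 <= delta * j%:R.
  rewrite mulrC -ler_pdivrMr // div1r; apply: le_trans (ltW (archi_boundP _)) _.
    by rewrite invr_ge0 ltW.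
  by rewrite ler_nat leq_maxr.
have j0 : (0 < j)%N.
  by rewrite lt0n; apply: contraTneq dj => ->; rewrite mulr0 -ltNge ltr01.
pose m := (24 * 96 * j)%N; have m0 : (0 < m)%N by rewrite !muln_gt0.
have hj : 32 * m%:R ^+ 2 * (1 - delta) ^+ j <= 1 / 2 :> R.
  have := hJ0 j (leq_maxl _ _); rewrite /m [X in 32 * X ^+ 2]natrM exprMn.
  by move: (_ %:R ^+ 2) (_ ^+ j) => u v; lra.
have [|K1 hK1] := @exists_many_choices R (2^-1 ^+ 24) g g0 g1.
  by rewrite exprn_gt0 ?invr_gt0.
have c0 : 0 < 24 * 8 ^+ 3 :> R by rewrite mulr_gt0 ?exprn_gt0.
have [|||K2 hK2] := @exists_many_choices R (1 / 4 / (24 * 8 ^+ 3)) 2^-1.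
- by rewrite invr_ge0.
- by rewrite invf_lt1 ?ltr1n.
- by rewrite !divr_gt0.
exists (maxn (16 * m ^ 2).+1 (maxn K1 K2) + 6)%N => k hk eta eta0.
have [i Ek] : exists i, k = (i + 6)%N by exists (k - 6)%N; rewrite subnK // (leq_trans _ hk) ?leq_addl.
subst k; move: hk; rewrite leq_add2r !geq_max => /and3P[im iK1 iK2].
have km : (16 * m ^ 2 < i + 6)%N by apply: leq_trans im _; rewrite leq_addr.
have hi : 24 * 8 ^+ 3 * (i + 6)%:R * 2^-1 ^+ i <= 1 / 4 :> R.
  by rewrite -mulrA mulrC -ler_pdivlMr // hK2.
have hg : (i + 6)%:R * g ^+ (i + 5) <= 2^-1 ^+ 24.
  apply: le_trans (hK1 i iK1); rewrite ler_wpM2l // ler_wiXn2l ?(ltW g1) //.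
  by rewrite leq_addr.
set theta : R := 1 - 1 / (4 * m%:R).
have mR : 1 <= m%:R :> R by rewrite ler1n.
have im4 : 1 / (4 * m%:R) <= 1 / 4 :> R.
  by rewrite ler_pdivrMr ?mulr_gt0 ?ltr0n //; lra.
have th0 : 0 <= theta by rewrite /theta; lra.
have th1 : theta < 1 by rewrite /theta gtrBl divr_gt0 // mulr_gt0 // ltr0n.
have [J hJ] := sqr_geometric_le1 (4 / eta) th0 th1.
(* The three bounds give [t > J], [7 / n <= eta / 2], and [i + 5 <= delta * n] for the choices left
   after deletion. *)
exists (maxn (J.+1 * m) (maxn (Num.bound (14 / eta)) (Num.bound ((i + 5)%:R / delta)))).
move=> V N ham; rewrite !geq_max => /and3P[nJ neta ndelta] Nirr hham hN.
set n := #|V| in nJ neta ndelta hN *; set F := ffam _.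
pose t := (n %/ m)%N.
have tJ : (J < t)%N by rewrite leq_divRL.
have t0 : (0 < t)%N by apply: leq_ltn_trans tJ.
have tmn : (t * m <= n)%N by rewrite leq_trunc_div.
have ntm : (n <= 2 * m * t)%N.
  rewrite {1}(divn_eq n m) -/t mulnAC [(2 * t)%N]mul2n -addnn mulnDl leq_add2l.
  by rewrite ltnW // (leq_trans (ltn_pmod _ m0)) // leq_pmull.
have mn : (m <= n)%N by apply: leq_trans tmn; rewrite leq_pmull.
have n0 : (0 < n)%N by apply: leq_trans mn.
have nR : 0 < n%:R :> R by rewrite ltr0n.
(* 24 is twice the 12 of [many_linked]; 96 is twice the 48 in [n <= 48 * h], so that
   [2 * n * b <= h * h]. With [m = 24 * 96 * j] this makes [t] equal to [b %/ j]. *)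
pose h := (n %/ 24)%N; pose b := (h %/ 96)%N.
have Et : t = (b %/ j)%N by rewrite /t /m !divnMA.
have n48 : (n <= 48 * h)%N.
  have h1 : (0 < h)%N.
    rewrite divn_gt0 // (leq_trans _ mn) // /m -mulnA leq_pmulr // muln_gt0 j0.
    by [].
  rewrite {1}(divn_eq n 24) -/h (_ : 48 = 24 + 24)%N // mulnDl mulnC leq_add2l.
  by rewrite ltnW // (leq_trans (ltn_pmod _ _)) // leq_pmulr.
have hb : (2 * (n * b) <= h * h)%N.
  apply: leq_trans (_ : 2 * (48 * h * b) <= _)%N; first by rewrite !(leq_mul2l, leq_mul2r) n48 orbT.
  have -> : (2 * (48 * h * b) = h * (b * 96))%N by ring.
  by rewrite leq_mul2l leq_trunc_div orbT.
pose y := (h %/ 2)%N.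
have hy : (2 * y <= h)%N by rewrite mulnC leq_trunc_div.
have ty : (t <= y)%N.
  rewrite Et; apply: leq_trans (leq_div _ _) _; exact: leq_div2l.
have jtb : (j * t <= b)%N by rewrite Et mulnC leq_trunc_div.
have h24 : (24 * h <= n)%N by rewrite mulnC leq_trunc_div.
have ht : t%:R <= delta * n%:R.
  have : (t * m)%:R <= n%:R :> R by rewrite ler_nat.
  have jm : j%:R <= m%:R :> R by rewrite ler_nat leq_pmull.
  rewrite natrM => h1; have h2 : delta * (t%:R * m%:R) <= delta * n%:R by rewrite ler_wpM2l // ltW.
  apply: le_trans h2; rewrite mulrCA ler_peMr //.
  by apply: le_trans dj _; rewrite ler_wpM2l // ltW.
have hNd v : (1 / 2 + delta) * n%:R + (i + 5)%:R <= #|N v|%:R.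
  apply: le_trans (hN v).
  have : (i + 5)%:R / delta <= n%:R.
    apply: le_trans (ltW (archi_boundP _)) _; first by rewrite divr_ge0 // ltW.
    by rewrite ler_nat.
  rewrite ler_pdivrMr // => h1.
  have -> : eps = delta + delta by rewrite /delta; field.
  by rewrite !mulrDl in h1 *; lra.
have hNg v : n%:R / 2 <= g * #|N v|%:R.
  rewrite [leRHS]mulrC ler_pdivlMr; last by lra.
  by apply: le_trans (hN v); rewrite le_eqVlt; apply/orP; left; apply/eqP; field.
have part1 := card_not_spreading g0 (ltW g1) n0 hNg hi hg.
have part2 := card_spreading_nonham Nirr hham d0 d1 n0 hNd h24 hb ht hy.
have rate := failure_rate d0 d1 m0 t0 (introT andP (conj tmn ntm)) jtb ty hj km.
rewrite -/theta in rate; rewrite -addnS -/n in part2; rewrite -/F in part1 part2.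
clearbody t theta.
have ntail : 7 / n%:R <= eta / 2.
  have : 14 / eta <= n%:R.
    apply: le_trans (ltW (archi_boundP _)) _; first by rewrite divr_ge0 // ltW.
    by rewrite ler_nat.
  rewrite ler_pdivrMr // ler_pdivrMr // => n14; clear -n14; lra.
have ttail : 2 * theta ^+ t <= eta / 2.
  have := hJ t (ltnW tJ).
  have t2 : 1 <= t%:R ^+ 2 :> R by rewrite exprn_ege1 // ler1n.
  have tht : 0 <= theta ^+ t by rewrite exprn_ge0.
  have -> : 4 / eta * t%:R ^+ 2 * theta ^+ t = 4 * (t%:R ^+ 2 * theta ^+ t) / eta by ring.
  rewrite ler_pdivrMr // mul1r => h4.
  have : theta ^+ t <= t%:R ^+ 2 * theta ^+ t by rewrite ler_peMl.
  clear -h4; lra.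
pose bad := [set c in F | spreading 1 c && ~~ ham c].
have hbad : #|bad|%:R <= 2 * theta ^+ t * #|F|%:R.
  have pos : 0 < (i + 5).-1%:R ^+ n :> R.
    by rewrite exprn_gt0 // ltr0n addnS /= addn_gt0 orbT.
  rewrite -(ler_pM2r pos); apply: le_trans part2 _.
  (* With [k = i + 6], the loss [(k / (k - 2)) ^ n] of the double count cancels the last factor of
     [failure_rate]. *)
  have -> : (i + 5).-1%:R = (1 - 2 / (i + 6)%:R) * (i + 6)%:R :> R.
    rewrite mulrBl mul1r divfK ?pnatr_eq0 ?addnS //.
    by rewrite -natrB ?ltnS // !subSS subn0.
  by rewrite exprMn mulrACA [#|F|%:R * _]mulrC ler_wpM2r ?mulr_ge0 ?exprn_ge0.
have cover : [set c in F | ~~ ham c] \subset [set c in F | ~~ spreading 1 c] :|: bad.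
  apply/subsetP => c; rewrite !inE => /andP[-> nh] /=.
  by case: (spreading 1 c); rewrite /= ?nh.
apply: le_trans (_ : (#|[set c in F | ~~ spreading 1 c]| + #|bad|)%:R <= _).
  rewrite ler_nat; apply: leq_trans (subset_leq_card cover) _.
  exact: leq_card_setU.
rewrite natrD; apply: le_trans (lerD part1 hbad) _.
by rewrite -mulrDl ler_wpM2r //; clear -ntail ttail; lra.
Qed.

Theorem theorem2 (R : realType) (eps : R) :
  0 < eps ->
  exists k_eps : nat, forall k : nat, (k_eps <= k)%N ->
  forall (nv : nat -> nat) (G : forall i : nat, rel 'I_(nv i)),
    (forall M : nat, exists I : nat, forall i : nat, (I <= i)%N -> (M <= nv i)%N) ->
    (forall i : nat, simple_graph (G i)) ->
    (forall (i : nat) (v : 'I_(nv i)),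
        (1 / 2 + eps) * (nv i)%:R <= (#|nbhd (G i) v|)%:R) ->
    forall eta : R, 0 < eta ->
      exists I : nat, forall i : nat, (I <= i)%N ->
        1 - eta <= prob_Gk_ham R (G i) k.
Proof.
(* [nonham_rare] takes [eps <= 1]; lowering [eps] only weakens the degree condition. *)
move=> e0; pose e := Num.min eps 1.
have [||K hK] := @nonham_rare R e; first by rewrite lt_min e0 ltr01.
  by rewrite ge_min lexx orbT.
exists K => k kK nv G nv_oo Gsimple Gdeg eta eta0.
have [n0 hn0] := hK k kK eta eta0.
(* The 3 serves [2 < n] in [hamiltonianb]; [k.*2 <= n] keeps [k] below every degree, so valid
   choices exist and the quotient is a true probability. *)
have [I hI] := nv_oo (maxn n0 (maxn 3 k.*2)).
exists I => i /hI; rewrite !geq_max => /and3P[ni n3 nk].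
have [Gsym Girr] := Gsimple i; have Gd := Gdeg i; move: (G i) => r in Gsym Girr Gd *.
move: (nv i) r ni n3 nk Gsym Girr Gd => n r ni n3 nk Gsym Girr Gd.
set F := ffam (fun v => ksets (nbhd r v) k).
have FE : [set c : {ffun 'I_n -> {set 'I_n}} | valid_choice r k c] = F.
  apply/setP => c; rewrite !inE; apply: eq_forallb => v.
  by rewrite inE.
pose ham (c : {ffun 'I_n -> {set 'I_n}}) := hamiltonianb (Gk_rel c).
have hE : [set c : {ffun 'I_n -> {set 'I_n}} | valid_choice r k c && hamiltonianb (Gk_rel c)]
    = [set c in F | ham c].
  by apply/setP => c; rewrite -FE !inE.
have F0 : (0 < #|F|)%N.
  rewrite card_ffam prodn_gt0 // => v; rewrite card_ksets bin_gt0.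
  rewrite -(ler_nat R); apply: le_trans (Gd v).
  have : (k.*2)%:R <= n%:R :> R by rewrite ler_nat.
  rewrite -mul2n natrM => h2; have : 0 <= eps * n%:R by rewrite mulr_ge0 // ltW.
  lra.
have := hn0 'I_n (nbhd r) ham _ _ _ _; rewrite card_ord -/F => /(_ ni) main.
have {main} : #|[set c in F | ~~ ham c]|%:R <= eta * #|F|%:R.
  apply: main => [v|c nh C uC sC|v].
  - by rewrite inE Girr.
  - apply: contra nh => cC; rewrite /ham /hamiltonianb n3 /=.
    have Cn : size C == n by rewrite sC.
    by apply/existsP; exists (Tuple Cn); rewrite uC.
  - apply: le_trans (Gd v); rewrite ler_wpM2r // lerD2l.
    by rewrite ge_min lexx.
move=> main; have cF : #|F| = (#|[set c in F | ham c]| + #|[set c in F | ~~ ham c]|)%N.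
  rewrite -(cardsID [set c | ham c] F); congr (_ + _)%N; apply: eq_card => c.
    by rewrite !inE.
  by rewrite !inE andbC.
rewrite /prob_Gk_ham hE FE ler_pdivlMr ?ltr0n // mulrBl mul1r lerBlDr.
by rewrite {1}cF natrD lerD2l.
Qed.
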